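(* Let $(M,J,g)$ be a complex Norden manifold whose natural canonical connection $D$ is flat (has zero curvature). Let $$\tilde J=\Phi^{D}\circ\widehat J\circ(\Phi^{D})^{-1},\qquad \tilde g=((\Phi^{D})^{-1})^{\star}(\widehat g)$$ be the structure on $T^{\star}(M)$ obtained by transporting the Norden structure $(\widehat J,\widehat g)$ of $T(M)\oplus T^{\star}(M)$ through $\Phi^{D}$. Then $(T^{\star}(M),\tilde J,\tilde g)$ is a complex Norden manifold.
   Context: $M$ is a smooth manifold of dimension $n$. A Norden manifold $(M,J,g)$ is an almost complex manifold $(M,J)$ ($J^2=-I$) with a pseudo-Riemannian metric $g$ such that $g(JX,Y)=g(X,JY)$ for all $X,Y$. It is a complex Norden manifold if moreover $J$ is integrable (its Nijenhuis tensor vanishes). Natural canonical connection. On a complex Norden manifold $(M,J,g)$ there is a unique linear connection $D$, with torsion $T(X,Y)=D_XY-D_YX-[X,Y]$, such that for all vector fields $X,Y,Z$: $(D_Xg)(Y,Z)=0$; $T(JX,Y)+T(X,JY)=0$; $g(T(X,Y),Z)+g(T(Y,Z),X)+g(T(Z,X),Y)=0$. It is called the natural canonical connection, and is given by $D_XY=\nabla_XY-\frac12 J(\nabla_XJ)Y$ with $\nabla$ the Levi-Civita connection of $g$; in particular $DJ=0$. Norden structure on $T(M)\oplus T^{\star}(M)$. Let $\flat:T(M)\to T^{\star}(M)$, $\flat(X)(Y)=g(X,Y)$, also denoted $g$, $\natural=\flat^{-1}$, and $J^{\star}(\xi)(X)=\xi(JX)$. Define $$\widehat J(X+\xi)=JX+g(X)-J^{\star}(\xi),$$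 $$\widehat g(X+\xi,Y+\eta)=g(X,Y)+\tfrac12 g(JX,\natural\eta)+\tfrac12 g(\natural\xi,JY)+g(\natural\xi,\natural\eta).$$ The map $\Phi^{D}$. Let $\Gamma^k_{il}$ be the Christoffel symbols of $D$: $D_{\partial/\partial x^i}\frac{\partial}{\partial x^l}=\Gamma^k_{il}\frac{\partial}{\partial x^k}$ in local coordinates $x^1,\dots,x^n$ of $M$, and let $\tilde x^1,\dots,\tilde x^n,y_1,\dots,y_n$ be the corresponding local coordinates on $T^{\star}(M)$. For each $p\in T^{\star}(M)$ over $x\in M$, $\Phi^{D}:T_xM\oplus T_x^{\star}M\to T_p(T^{\star}(M))$ is the linear isomorphism with $$\Phi^{D}\Big(\frac{\partial}{\partial x^i}\Big)=\frac{\partial}{\partial\tilde x^i}+y_k\Gamma^k_{il}\frac{\partial}{\partial y_l},\qquad \Phi^{D}(dx^j)=\frac{\partial}{\partial y_j}$$ (summation over repeated indices), i.e. the $D$-horizontal lift on vectors and the vertical lift on covectors. The formulas for $\tilde J,\tilde g$ are understood pointwise at each $p\in T^{\star}(M)$. *)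

(* Defs.v *)
From HB Require Import structures.
From mathcomp Require Import all_boot all_order all_algebra.
From mathcomp Require Import all_classical all_reals all_analysis.
Set Implicit Arguments.
Unset Strict Implicit.
Unset Printing Implicit Defensive.
Import Order.TTheory GRing.Theory Num.Theory.
Import numFieldNormedType.Exports.
Local Open Scope classical_set_scope.
Local Open Scope ring_scope.

(* All of this is meant for open U, where f is C^(k+1) iff it is
   differentiable with all its directional derivatives of class C^k. *)
Fixpoint Ck (R : realType) (m : nat) (V : normedModType R) (k : nat)
    (U : set 'rV[R]_m) (f : 'rV[R]_m -> V) : Prop :=
  match k with
  | 0 => forall x, U x -> {for x, continuous f}
  | k'.+1 => (forall x, U x -> differentiable f x) /\
             (forall v, Ck k' U (fun x => 'D_v f x))
  end.

Definition smooth_on (R : realType) (m : nat) (V : normedModType R)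
    (U : set 'rV[R]_m) (f : 'rV[R]_m -> V) : Prop :=
  forall k, Ck k U f.

(* [psi i] is the inverse of the chart [phi i : dom i -> R^n]; only its values
   on [phi i @` dom i] matter.  [ch x] is some chart around x, singled out once
   and for all: a tangent vector at x is represented by its row of components in
   the chart [ch x], and a covector by the row of its components in the dual
   basis. *)
Record atlas (R : realType) (n : nat) := Atlas {
  carrier :> topologicalType;
  chart_index : Type;
  dom : chart_index -> set carrier;
  phi : chart_index -> carrier -> 'rV[R]_n;
  psi : chart_index -> 'rV[R]_n -> carrier;
  ch : carrier -> chart_index }.

Section Manifold.
Variables (R : realType) (n : nat) (M : atlas R n).
Implicit Types (i j c : chart_index M) (x y : M) (W : set M) (v : 'rV[R]_n).

Record smooth_manifold : Prop := SmoothManifold {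
  mfd_hausdorff : hausdorff_space M;
  mfd_second_countable : @second_countable M;
  mfd_dom_open : forall i, open (dom i);
  mfd_img_open : forall i, open (phi i @` dom i);
  mfd_phiK : forall i x, dom i x -> psi i (phi i x) = x;
  mfd_phi_cont : forall i, {within dom i, continuous (phi i)};
  mfd_psi_cont : forall i, {within phi i @` dom i, continuous (psi i)};
  mfd_transition : forall i j,
    smooth_on (phi i @` (dom i `&` dom j)) (phi j \o psi i);
  mfd_ch : forall x, dom (ch x) x }.

(* If v is the row of components in chart i of a tangent vector at x, then
   [v *m jac i j x] is its row of components in chart j. *)
Definition jac i j x : 'M[R]_n := jacobian (phi j \o psi i) (phi i x).

Definition vfield := M -> 'rV[R]_n.
Definition endo_field := M -> 'rV[R]_n -> 'rV[R]_n.
Definition bilin_field := M -> 'rV[R]_n -> 'rV[R]_n -> R.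

Definition components i (X : vfield) (u : 'rV[R]_n) : 'rV[R]_n :=
  let x := psi i u in X x *m jac (ch x) i x.

Definition smooth_fun W (f : M -> R) : Prop :=
  forall i, smooth_on (phi i @` (W `&` dom i)) (f \o psi i : _ -> R^o).

Definition smooth_vf W (X : vfield) : Prop :=
  forall i, smooth_on (phi i @` (W `&` dom i)) (components i X).

Definition dirder x v (f : M -> R) : R :=
  'D_v (f \o psi (ch x) : _ -> R^o) (phi (ch x) x).

Definition lie (X Y : vfield) : vfield := fun x =>
  let c := ch x in
  'D_(X x) (components c Y) (phi c x) - 'D_(Y x) (components c X) (phi c x).

Definition apply_endo (A : endo_field) (X : vfield) : vfield :=
  fun x => A x (X x).

Record norden (J : endo_field) (g : bilin_field) : Prop := Norden {
  nor_manifold : smooth_manifold;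
  nor_J_linear : forall x, linear (J x);
  nor_J_smooth : forall W X, open W -> smooth_vf W X ->
    smooth_vf W (apply_endo J X);
  nor_J_sq : forall x v, J x (J x v) = - v;
  nor_g_linear : forall x v, scalar (g x v);
  nor_g_sym : forall x v w, g x v w = g x w v;
  nor_g_nondeg : forall x v, (forall w, g x v w = 0) -> v = 0;
  nor_g_smooth : forall W X Y, open W -> smooth_vf W X -> smooth_vf W Y ->
    smooth_fun W (fun x => g x (X x) (Y x));
  nor_compat : forall x v w, g x (J x v) w = g x v (J x w) }.

Definition nijenhuis (J : endo_field) (X Y : vfield) : vfield := fun x =>
  lie (apply_endo J X) (apply_endo J Y) x - J x (lie (apply_endo J X) Y x)
  - J x (lie X (apply_endo J Y) x) - lie X Y x.

Definition complex_norden (J : endo_field) (g : bilin_field) : Prop :=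
  norden J g /\
  forall W X Y, open W -> smooth_vf W X -> smooth_vf W Y ->
    forall x, W x -> nijenhuis J X Y x = 0.

(* [D x v Y] is the covariant derivative at x of the vector field Y in the
   direction of the tangent vector v. *)
Definition connection := forall x, 'rV[R]_n -> vfield -> 'rV[R]_n.

Definition cov (D : connection) (X Y : vfield) : vfield := fun x => D x (X x) Y.

(* The axioms are imposed on fields that are smooth on some open W; the values
   of D on other fields are irrelevant. *)
Record linear_connection (D : connection) : Prop := LinearConnection {
  con_local : forall W Y Y', open W -> smooth_vf W Y ->
    (forall y, W y -> Y y = Y' y) -> forall x v, W x -> D x v Y = D x v Y';
  con_linear : forall W Y, open W -> smooth_vf W Y ->
    forall x, W x -> linear (fun v => D x v Y);
  con_add : forall W Y Z, open W -> smooth_vf W Y -> smooth_vf W Z ->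
    forall x v, W x -> D x v (fun y => Y y + Z y) = D x v Y + D x v Z;
  con_leibniz : forall W f Y, open W -> smooth_fun W f -> smooth_vf W Y ->
    forall x v, W x ->
    D x v (fun y => f y *: Y y) = dirder x v f *: Y x + f x *: D x v Y;
  con_smooth : forall W X Y, open W -> smooth_vf W X -> smooth_vf W Y ->
    smooth_vf W (cov D X Y) }.

Definition torsion (D : connection) (X Y : vfield) : vfield := fun x =>
  cov D X Y x - cov D Y X x - lie X Y x.

Definition curvature (D : connection) (X Y Z : vfield) : vfield := fun x =>
  cov D X (cov D Y Z) x - cov D Y (cov D X Z) x - cov D (lie X Y) Z x.

Definition flat_connection (D : connection) : Prop :=
  forall W X Y Z, open W -> smooth_vf W X -> smooth_vf W Y -> smooth_vf W Z ->
  forall x, W x -> curvature D X Y Z x = 0.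

Definition metric_connection (g : bilin_field) (D : connection) : Prop :=
  forall W X Y Z, open W -> smooth_vf W X -> smooth_vf W Y -> smooth_vf W Z ->
  forall x, W x ->
    dirder x (X x) (fun y => g y (Y y) (Z y))
    - g x (cov D X Y x) (Z x) - g x (Y x) (cov D X Z x) = 0.

Record levi_civita (g : bilin_field) (D : connection) : Prop := LeviCivita {
  lc_connection : linear_connection D;
  lc_metric : metric_connection g D;
  lc_torsion : forall W X Y, open W -> smooth_vf W X -> smooth_vf W Y ->
    forall x, W x -> torsion D X Y x = 0 }.

(* The first four conditions alone do not determine D (they do together with
   D J = 0); the last one is the explicit formula
   D_X Y = nabla_X Y - 1/2 J ((nabla_X J) Y), nabla the Levi-Civita connection
   and (nabla_X J) Y = nabla_X (J Y) - J (nabla_X Y). *)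
Record natural_canonical (J : endo_field) (g : bilin_field) (D : connection)
    : Prop := NaturalCanonical {
  nat_connection : linear_connection D;
  nat_metric : metric_connection g D;
  nat_torsion : forall W X Y, open W -> smooth_vf W X -> smooth_vf W Y ->
    forall x, W x ->
    torsion D (apply_endo J X) Y x + torsion D X (apply_endo J Y) x = 0;
  nat_cyclic : forall W X Y Z,
    open W -> smooth_vf W X -> smooth_vf W Y -> smooth_vf W Z ->
    forall x, W x ->
    g x (torsion D X Y x) (Z x) + g x (torsion D Y Z x) (X x)
    + g x (torsion D Z X x) (Y x) = 0;
  nat_formula : exists2 nabla : connection, levi_civita g nabla &
    forall W X Y, open W -> smooth_vf W X -> smooth_vf W Y ->
    forall x, W x ->
    cov D X Y x = cov nabla X Y x
      - 2^-1 *: J x (cov nabla X (apply_endo J Y) x - J x (cov nabla X Y x)) }.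

Definition ebase (m : nat) (a : 'I_m) : 'rV[R]_m := delta_mx 0 a.

Definition coord_vf c (a : 'I_n) : vfield := fun x => ebase a *m jac c (ch x) x.

(* [christoffel D c x k a l] is Gamma^k_{al} at x in the chart c. *)
Definition christoffel (D : connection) c x (k a l : 'I_n) : R :=
  (cov D (coord_vf c a) (coord_vf c l) x *m jac (ch x) c x) 0 k.

(* Elements X + xi of T_x M (+) T_x^* M are represented by [row_mx X xi]. *)
Definition pairing (xi v : 'rV[R]_n) : R := \sum_(a < n) xi 0 a * v 0 a.

Definition musical_flat (g : bilin_field) x v : 'rV[R]_n :=
  \row_a g x v (ebase a).

Definition musical_sharp (g : bilin_field) x (xi : 'rV[R]_n) : 'rV[R]_n :=
  xi *m invmx (lin1_mx (musical_flat g x)).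

Definition Jstar (J : endo_field) x (xi : 'rV[R]_n) : 'rV[R]_n :=
  \row_a pairing xi (J x (ebase a)).

Definition Jhat (J : endo_field) (g : bilin_field) x (w : 'rV[R]_(n + n))
    : 'rV[R]_(n + n) :=
  let X := lsubmx w in let xi := rsubmx w in
  row_mx (J x X) (musical_flat g x X - Jstar J x xi).

Definition ghat (J : endo_field) (g : bilin_field) x (w w' : 'rV[R]_(n + n))
    : R :=
  let X := lsubmx w in let xi := rsubmx w in
  let Y := lsubmx w' in let eta := rsubmx w' in
  g x X Y + 2^-1 * g x (J x X) (musical_sharp g x eta)
  + 2^-1 * g x (musical_sharp g x xi) (J x Y)
  + g x (musical_sharp g x xi) (musical_sharp g x eta).

End Manifold.

Section Cotangent.
Variables (R : realType) (n : nat) (M : atlas R n).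

Record cotangent_space : Type := Covector { base : M; fiber : 'rV[R]_n }.
HB.instance Definition _ := gen_eqMixin cotangent_space.
HB.instance Definition _ := gen_choiceMixin cotangent_space.

(* A chart i of M induces the chart (x, xi) |-> (phi i x, xi_i), where
   xi_i(v_i) = xi(v), i.e. xi_i = xi *m (jac i (ch x) x)^T. *)
Definition cot_dom (i : chart_index M) : set cotangent_space :=
  [set p | dom i (base p)].

Definition cot_phi (i : chart_index M) (p : cotangent_space)
    : 'rV[R]_(n + n) :=
  let x := base p in row_mx (phi i x) (fiber p *m (jac i (ch x) x)^T).

Definition cot_psi (i : chart_index M) (u : 'rV[R]_(n + n))
    : cotangent_space :=
  let x := psi i (lsubmx u) in Covector x (rsubmx u *m (jac (ch x) i x)^T).

(* The topology of T^*M is the one making its charts homeomorphisms. *)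
Definition cot_open (O : set cotangent_space) : Prop :=
  forall i u, (phi i @` dom i) (lsubmx u) -> O (cot_psi i u) ->
  \forall u' \near u, (phi i @` dom i) (lsubmx u') -> O (cot_psi i u').

Fact cot_openT : cot_open setT.
Proof. by move=> i u _ _; near=> u'. Unshelve. all: by end_near. Qed.

Fact cot_openI : setI_closed cot_open.
Proof.
move=> A B oA oB i u iu [Au Bu]; have := oB i u iu Bu; have := oA i u iu Au.
by apply: filterS2 => u' Au' Bu' iu'; split; [apply: Au'|apply: Bu'].
Qed.

Fact cot_open_bigU (I : Type) (f : I -> set cotangent_space) :
  (forall k, cot_open (f k)) -> cot_open (\bigcup_k f k).
Proof.
move=> of_ i u iu [k _ fku]; have := of_ k i u iu fku.
apply: filterS => u' fu' iu'.
exists k; first by [].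
exact: fu'.
Qed.

HB.instance Definition _ :=
  isOpenTopological.Build cotangent_space cot_openT cot_openI cot_open_bigU.

Definition cotangent : atlas R (n + n) :=
  @Atlas R (n + n) cotangent_space (chart_index M) cot_dom cot_phi cot_psi
    (fun p => ch (base p)).

(* Row a is the image of d/dx^a and row n + a that of dx^a, in the coordinates
   induced on T^*M by the chart [ch x], which are also those in which tangent
   vectors of [cotangent] at p are represented. *)
Definition PhiD_mx (D : connection M) (p : cotangent) : 'M[R]_(n + n) :=
  let x := base p in let y := fiber p in
  block_mx
    1%:M (\matrix_(a < n, l < n)
            \sum_(k < n) y 0 k * christoffel D (ch x) x k a l)
    0    1%:M.

Definition PhiD (D : connection M) (p : cotangent) (w : 'rV[R]_(n + n)) :=
  w *m PhiD_mx D p.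

Definition PhiD_inv (D : connection M) (p : cotangent) (w : 'rV[R]_(n + n)) :=
  w *m invmx (PhiD_mx D p).

Definition Jtilde (J : endo_field M) (g : bilin_field M) (D : connection M)
    : endo_field cotangent :=
  fun p w => PhiD D p (Jhat J g (base p) (PhiD_inv D p w)).

Definition gtilde (J : endo_field M) (g : bilin_field M) (D : connection M)
    : bilin_field cotangent :=
  fun p w w' => ghat J g (base p) (PhiD_inv D p w) (PhiD_inv D p w').

End Cotangent.

(* Main.v *)
From HB Require Import structures.
From mathcomp Require Import all_boot all_order all_algebra.
From mathcomp Require Import all_classical all_reals all_analysis.
From mathcomp Require Import lra.
Require Import Defs.
Set Implicit Arguments.
Unset Strict Implicit.
Unset Printing Implicit Defensive.
Import Order.TTheory GRing.Theory Num.Theory.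
Import numFieldNormedType.Exports.
Local Open Scope classical_set_scope.
Local Open Scope ring_scope.

(** The isomorphism Phi^D identifies each tangent space of the cotangent bundle
    with T_x M (+) T_x^* M, where the identities of a Norden structure (the square
    of J is -1, g is symmetric and nondegenerate, J is g-symmetric) are block
    matrix computations: [Jhat_mx_sq], [ghat_mx_sym], [ghat_mx_inj],
    [Jhat_ghat_mx].  What remains is that the cotangent bundle is a manifold
    ([cotangent_manifold]), that the transported structure is smooth, and that its
    Nijenhuis tensor vanishes.

    In a chart, with vectors as rows, write A and G for the matrices of J and g,
    and D_v Y = d_v Y + Y Gamma_v ([connectionE]).  Phi^D is the block matrix with
    rows (1, P) and (0, 1), where v P = y Gamma_v^T at the covector y.  Smoothness
    holds because the transported structure has the same matrix expression in
    every chart ([Jtilde_change], [gtilde_change]); this is the independence of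
    the horizontal lift from the chart ([lift_change]), that is, the
    transformation law of the connection matrix ([gamma_change]).

    For integrability, let X^h be the horizontal lift of a vector field and xi^v
    the vertical lift of a 1-form.  Since D is flat, [X^h, Y^h] = [X, Y]^h, while
    [X^h, xi^v] = (D_X xi)^v and [xi^v, eta^v] = 0.  As D J = 0 ([dJE]) and
    D g = 0 ([dgE]), the mixed values N(X^h, xi^v) vanish, the horizontal part of
    N(X^h, Y^h) is the Nijenhuis tensor of J, and its vertical part is
    g(T(J X, Y) + T(X, J Y)), which is zero by the torsion condition
    ([torsion_JE]).  That condition and D J = 0 also give the vanishing of the
    Nijenhuis tensor of J ([nijenhuis_algebra1]).  The computation is done
    pointwise: in coordinates N(X, Y) involves only the values of X and Y at the
    point and the first derivatives of the matrix of the structure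
    ([nijenhuis_coord]), and flatness is the symmetry in v and w of
    d_v Gamma_w + Gamma_w Gamma_v ([flatE]). *)

(** * Smooth functions on open subsets of R^m *)

Lemma near_open (T : topologicalType) (U : set T) u (P : T -> Prop) :
  open U -> U u -> (forall w, U w -> P w) -> \forall w \near u, P w.
Proof.
move=> oU Uu UP; have : nbhs u U by exact: open_nbhs_nbhs.
by apply: filterS.
Qed.

Lemma near_eq_differentiable (R : realType) (V W : normedModType R)
    (f g : V -> W) u :
  (\forall w \near u, f w = g w) -> differentiable f u -> differentiable g u.
Proof.
move=> fg df.
have [cf ef] := (diff_locallyP u f).1 df.
have eg : g \o shift u = cst (g u) + 'd f u +o_ 0 id.
  apply/eqaddoP => e e0; move/eqaddoP : ef => /(_ e e0) fe.
  have fg0 : \forall w \near (0 : V), f (u + w) = g (u + w).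
    exact/(nbhs0P (fun w => f w = g w)).
  apply: filterS2 fg0 fe => w /= fgw.
  rewrite !fctE /= (addrC w u) fgw.
  by rewrite (nbhs_singleton fg).
have dg : 'd g u = 'd f u :> (_ -> _) by exact: diff_unique.
by apply/diff_locallyP; rewrite dg.
Qed.

Section Calculus.
Variables (R : realType) (m : nat).
Implicit Types (U : set 'rV[R]_m) (u v : 'rV[R]_m).

Section AnyTarget.
Variable V : normedModType R.
Implicit Types (f g : 'rV[R]_m -> V).

Lemma CkS k U f : Ck k.+1 U f -> Ck k U f.
Proof.
elim: k f => [|k IH] f [df Df].
  by move=> x Ux; apply: differentiable_continuous; apply: df.
by split=> // v; apply: IH; apply: Df.
Qed.

Lemma Ck_subset k U U' f : U' `<=` U -> Ck k U f -> Ck k U' f.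
Proof.
move=> sU; elim: k f => [|k IH] f /=; first by move=> cf x /sU; apply: cf.
by case=> df Df; split=> [x /sU|v]; [apply: df|apply: IH].
Qed.

Lemma Ck_eq k U f g : open U -> (forall u, U u -> f u = g u) ->
  Ck k U f -> Ck k U g.
Proof.
move=> oU; elim: k f g => [|k IH] f g fg /=.
  move=> cf x Ux.
  have e : \forall w \near x, f w = g w by exact: near_open Ux fg.
  rewrite /prop_for /continuous_at -(fg _ Ux).
  exact: (cvg_trans (@near_eq_cvg _ _ (nbhs x) _ _ _ e) (cf x Ux)).
case=> df Df; split=> [x Ux|v].
  by apply: near_eq_differentiable (df x Ux); exact: near_open Ux fg.
apply: IH (Df v) => u Uu; apply: near_eq_derive; exact: near_open Uu fg.
Qed.

Lemma smooth_subset U U' f : U' `<=` U -> smooth_on U f -> smooth_on U' f.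
Proof. by move=> sU sf k; apply: Ck_subset (sf k). Qed.

Lemma smooth_eq U f g : open U -> (forall u, U u -> f u = g u) ->
  smooth_on U f -> smooth_on U g.
Proof. by move=> oU fg sf k; apply: Ck_eq (sf k). Qed.

Lemma smooth_differentiable U f u : smooth_on U f -> U u -> differentiable f u.
Proof. by move=> sf; have [df _] := sf 1%N; apply: df. Qed.

Lemma smooth_derivable U f u v : smooth_on U f -> U u -> derivable f u v.
Proof. by move=> sf Uu; apply: diff_derivable; apply: smooth_differentiable Uu. Qed.

Lemma smooth_derive U f v : smooth_on U f -> smooth_on U ('D_v f).
Proof. by move=> sf k; have [_ ] := sf k.+1; apply. Qed.

Lemma Ck_cst k U (c : V) : Ck k U (fun=> c).
Proof.
elim: k c => [|k IH] c /=; first by move=> x _; exact: cst_continuous.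
split=> [x _|v]; first exact: differentiable_cst.
have -> : 'D_v (fun _ : 'rV[R]_m => c) = fun=> 0.
  by apply/funext => x; exact: derive_cst.
exact: IH.
Qed.

Lemma smooth_cst U (c : V) : smooth_on U (fun=> c).
Proof. by move=> k; exact: Ck_cst. Qed.

Lemma CkD k U f g : open U -> Ck k U f -> Ck k U g ->
  Ck k U (fun u => f u + g u).
Proof.
move=> oU; elim: k f g => [|k IH] f g /=.
  by move=> cf cg x Ux; apply: continuousD; [apply: cf|apply: cg].
move=> [df Df] [dg Dg]; split=> [x Ux|v].
  by apply: differentiableD; [apply: df|apply: dg].
apply: Ck_eq (IH _ _ (Df v) (Dg v)) => // u Uu.
rewrite -[RHS]/('D_v (f + g) u) deriveD //; apply: diff_derivable;
  [exact: df|exact: dg].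
Qed.

Lemma Ck_sum k U (I : Type) (r : seq I) (F : I -> 'rV[R]_m -> V) : open U ->
  (forall i, Ck k U (F i)) -> Ck k U (fun u => \sum_(i <- r) F i u).
Proof.
move=> oU sF; elim: r => [|i r IH].
  by apply: Ck_eq (Ck_cst k U 0) => // u _; rewrite big_nil.
by apply: Ck_eq (CkD oU (sF i) IH) => // u _; rewrite big_cons.
Qed.

Lemma CkZl k U (f : 'rV[R]_m -> R^o) (c : V) : open U ->
  Ck k U f -> Ck k U (fun u => f u *: c).
Proof.
move=> oU; elim: k f => [|k IH] f /=.
  by move=> cf x Ux; apply: continuousZr_tmp; apply: cf.
case=> df Df; split=> [x Ux|v].
  by apply: differentiableZl; exact: df.
apply: Ck_eq (IH _ (Df v)) => // u Uu.
have dfu := df u Uu.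
rewrite [RHS]deriveE; last exact: differentiableZl.
by rewrite diffZl //= -deriveE.
Qed.

End AnyTarget.

Section Scalar.
Implicit Types (f g : 'rV[R]_m -> R^o).

Lemma CkM k U f g : open U -> Ck k U f -> Ck k U g ->
  Ck k U (fun u => f u * g u : R^o).
Proof.
move=> oU; elim: k f g => [|k IH] f g.
  by move=> cf cg x Ux; apply: continuousM; [apply: cf|apply: cg].
move=> sf sg; have [df Df] := sf; have [dg Dg] := sg; split=> [x Ux|v].
  by apply: differentiableM; [apply: df|apply: dg].
apply: Ck_eq (CkD oU (IH _ _ (CkS sf) (Dg v)) (IH _ _ (CkS sg) (Df v))) => //.
move=> u Uu; rewrite -[RHS]/('D_v (f * g) u) deriveM //; apply: diff_derivable;
  [exact: df|exact: dg].
Qed.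

Lemma CkV k U f : open U -> (forall u, U u -> f u != 0) -> Ck k U f ->
  Ck k U (fun u => (f u)^-1 : R^o).
Proof.
move=> oU f0; elim: k => [|k IH].
  by move=> cf x Ux; apply: continuousV; [apply: f0|apply: cf].
move=> sf; have [df Df] := sf; split=> [x Ux|v].
  by apply: differentiableV; [apply: df|apply: f0].
have sI := IH (CkS sf).
have := CkM oU (CkM oU (Ck_cst k U (-1 : R^o)) (CkM oU sI sI)) (Df v).
apply: Ck_eq => // u Uu.
rewrite [RHS]deriveV //; [|exact: f0|apply: diff_derivable; exact: df].
by rewrite mulN1r -expr2 exprVn.
Qed.

Lemma Ck_coord k U (a : 'I_m) : open U -> Ck k U (fun u => u 0 a : R^o).
Proof.
case: k => [|k] oU; first by move=> x _; exact: coord_continuous.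
split=> [x _|v]; first exact: differentiable_coord.
apply: Ck_eq (Ck_cst k U (v 0 a : R^o)) => // u _.
have : derivable (id : 'rV[R]_m -> 'rV[R]_m) u v by exact: derivable_id.
move=> /derive_mx /matrixP/(_ 0 a); rewrite mxE => <-.
by rewrite derive_id.
Qed.

End Scalar.

(** A matrix-valued function is smooth iff its entries are. *)
Section Entries.
Variables p q : nat.
Implicit Types F : 'rV[R]_m -> 'M[R]_(p, q).

Lemma derive_entry F u v a b : derivable F u v ->
  ('D_v F u) a b = 'D_v (fun w => F w a b : R^o) u.
Proof. by move=> dF; rewrite derive_mx // mxE. Qed.

Lemma differentiable_entry F u a b : differentiable F u ->
  differentiable (fun w => F w a b : R^o) u.
Proof.
move=> dF.
apply: (@differentiable_comp _ _ _ _ F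
  (fun M : 'M[R]_(p, q) => M a b : R^o)) => //.
exact: differentiable_coord.
Qed.

Lemma Ck_entry k U F a b : open U -> Ck k U F ->
  Ck k U (fun u => F u a b : R^o).
Proof.
move=> oU; elim: k F => [|k IH] F.
  move=> cF x Ux; apply: (@continuous_comp _ _ _ F (fun M : 'M[R]_(p, q) => M a b)).
    exact: cF.
  exact: coord_continuous.
case=> dF DF; split=> [x Ux|v]; first exact/differentiable_entry/dF.
apply: Ck_eq (IH _ (DF v)) => // u Uu; apply: derive_entry.
exact/diff_derivable/dF.
Qed.

Lemma smooth_entry U F a b : open U -> smooth_on U F ->
  smooth_on U (fun u => F u a b : R^o).
Proof. by move=> oU sF k; apply: Ck_entry (sF k). Qed.

Lemma smooth_entries U F : open U ->
  (forall a b, smooth_on U (fun u => F u a b : R^o)) -> smooth_on U F.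
Proof.
move=> oU sF k.
have : Ck k U (fun u => \sum_(a < p) \sum_(b < q) F u a b *: delta_mx a b).
  by do 2!apply: Ck_sum => // ?; apply: CkZl => //; apply: sF.
by apply: Ck_eq => // u _; rewrite -matrix_sum_delta.
Qed.

End Entries.

End Calculus.

Section SmoothMatrices.
Variables (R : realType) (m : nat) (U : set 'rV[R]_m).
Hypothesis oU : open U.

Lemma smoothD (V : normedModType R) (f g : 'rV[R]_m -> V) :
  smooth_on U f -> smooth_on U g -> smooth_on U (fun u => f u + g u).
Proof. by move=> sf sg k; apply: CkD (sf k) (sg k). Qed.

Lemma smooth_sum (V : normedModType R) (I : Type) (r : seq I)
    (F : I -> 'rV[R]_m -> V) :
  (forall i, smooth_on U (F i)) -> smooth_on U (fun u => \sum_(i <- r) F i u).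
Proof. by move=> sF k; apply: Ck_sum => // i; apply: sF. Qed.

Lemma smoothM (f g : 'rV[R]_m -> R^o) :
  smooth_on U f -> smooth_on U g -> smooth_on U (fun u => f u * g u : R^o).
Proof. by move=> sf sg k; apply: CkM (sf k) (sg k). Qed.

Lemma smooth_prod (I : Type) (r : seq I) (F : I -> 'rV[R]_m -> R^o) :
  (forall i, smooth_on U (F i)) ->
  smooth_on U (fun u => \prod_(i <- r) F i u : R^o).
Proof.
move=> sF; elim: r => [|i r IH].
  by apply: smooth_eq (smooth_cst U (1 : R^o)) => // u _; rewrite big_nil.
by apply: smooth_eq (smoothM (sF i) IH) => // u _; rewrite big_cons.
Qed.

Lemma smoothV (f : 'rV[R]_m -> R^o) : (forall u, U u -> f u != 0) ->
  smooth_on U f -> smooth_on U (fun u => (f u)^-1 : R^o).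
Proof. by move=> f0 sf k; apply: CkV (sf k). Qed.

Lemma smooth_id : smooth_on U (id : 'rV[R]_m -> 'rV[R]_m).
Proof.
by apply: smooth_entries => // a b k; rewrite ord1; exact: Ck_coord.
Qed.

Lemma smooth_mulmx p q r (F : 'rV[R]_m -> 'M[R]_(p, q))
    (G : 'rV[R]_m -> 'M[R]_(q, r)) :
  smooth_on U F -> smooth_on U G -> smooth_on U (fun u => F u *m G u).
Proof.
move=> sF sG; apply: smooth_entries => // a b.
have : smooth_on U (fun u => \sum_c F u a c * G u c b : R^o).
  by apply: smooth_sum => c; apply: smoothM; apply: smooth_entry.
by apply: smooth_eq => // u _; rewrite mxE.
Qed.

Lemma smooth_trmx p q (F : 'rV[R]_m -> 'M[R]_(p, q)) :
  smooth_on U F -> smooth_on U (fun u => (F u)^T).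
Proof.
move=> sF; apply: smooth_entries => // a b.
by apply: smooth_eq (smooth_entry b a oU sF) => // u _; rewrite mxE.
Qed.

Lemma smooth_oppmx p q (F : 'rV[R]_m -> 'M[R]_(p, q)) :
  smooth_on U F -> smooth_on U (fun u => - F u).
Proof.
move=> sF; apply: smooth_eq (smooth_mulmx (smooth_cst U (- 1%:M)) sF) => // u _.
by rewrite mulNmx mul1mx.
Qed.

Lemma smooth_scalemx p q (f : 'rV[R]_m -> R^o) (F : 'rV[R]_m -> 'M[R]_(p, q)) :
  smooth_on U f -> smooth_on U F -> smooth_on U (fun u => f u *: F u).
Proof.
move=> sf sF; apply: smooth_entries => // a b.
by apply: smooth_eq (smoothM sf (smooth_entry a b oU sF)) => // u _; rewrite mxE.
Qed.

Lemma smooth_row_mx p q r (F : 'rV[R]_m -> 'M[R]_(p, q))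
    (G : 'rV[R]_m -> 'M[R]_(p, r)) :
  smooth_on U F -> smooth_on U G -> smooth_on U (fun u => row_mx (F u) (G u)).
Proof.
move=> sF sG; apply: smooth_entries => // a b.
case: (split_ordP b) => c ->.
  by apply: smooth_eq (smooth_entry a c oU sF) => // u _; rewrite row_mxEl.
by apply: smooth_eq (smooth_entry a c oU sG) => // u _; rewrite row_mxEr.
Qed.

Lemma smooth_col_mx p q r (F : 'rV[R]_m -> 'M[R]_(p, q))
    (G : 'rV[R]_m -> 'M[R]_(r, q)) :
  smooth_on U F -> smooth_on U G -> smooth_on U (fun u => col_mx (F u) (G u)).
Proof.
move=> sF sG; apply: smooth_entries => // a b.
case: (split_ordP a) => c ->.
  by apply: smooth_eq (smooth_entry c b oU sF) => // u _; rewrite col_mxEu.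
by apply: smooth_eq (smooth_entry c b oU sG) => // u _; rewrite col_mxEd.
Qed.

Lemma smooth_lsubmx p q r (F : 'rV[R]_m -> 'M[R]_(p, q + r)) :
  smooth_on U F -> smooth_on U (fun u => lsubmx (F u)).
Proof.
move=> sF; apply: smooth_entries => // a b.
by apply: smooth_eq (smooth_entry a (lshift r b) oU sF) => // u _; rewrite mxE.
Qed.

Lemma smooth_rsubmx p q r (F : 'rV[R]_m -> 'M[R]_(p, q + r)) :
  smooth_on U F -> smooth_on U (fun u => rsubmx (F u)).
Proof.
move=> sF; apply: smooth_entries => // a b.
by apply: smooth_eq (smooth_entry a (rshift q b) oU sF) => // u _; rewrite mxE.
Qed.

Lemma smooth_det p (F : 'rV[R]_m -> 'M[R]_p) :
  smooth_on U F -> smooth_on U (fun u => \det (F u) : R^o).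
Proof.
move=> sF; apply: smooth_sum => t; apply: smoothM; first exact: smooth_cst.
by apply: smooth_prod => a; apply: smooth_entry.
Qed.

End SmoothMatrices.

Section SmoothBlocks.
Variables (R : realType) (m : nat) (U : set 'rV[R]_m).
Hypothesis oU : open U.

Lemma smooth_block_mx p q r s (A : 'rV[R]_m -> 'M[R]_(p, q))
    (B : 'rV[R]_m -> 'M[R]_(p, r)) (C : 'rV[R]_m -> 'M[R]_(s, q))
    (E : 'rV[R]_m -> 'M[R]_(s, r)) :
  smooth_on U A -> smooth_on U B -> smooth_on U C -> smooth_on U E ->
  smooth_on U (fun u => block_mx (A u) (B u) (C u) (E u)).
Proof. by move=> *; apply: smooth_col_mx => //; apply: smooth_row_mx. Qed.

Lemma smooth_invmx p (F : 'rV[R]_m -> 'M[R]_p) :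
  (forall u, U u -> F u \in unitmx) -> smooth_on U F ->
  smooth_on U (fun u => invmx (F u)).
Proof.
move=> uF sF.
have : smooth_on U (fun u => (\det (F u))^-1 *: (\adj (F u))%R).
  apply: smooth_scalemx => //.
    by apply: smoothV (smooth_det oU sF) => // u Uu; rewrite -unitfE -unitmxE uF.
  apply: smooth_entries => // a b.
  have : smooth_on U
      (fun u => (-1) ^+ (b + a) * \det (row' b (col' a (F u))) : R^o).
    apply: smoothM => //; first exact: smooth_cst.
    apply: smooth_det => //; apply: smooth_entries => // c d.
    apply: smooth_eq (smooth_entry (lift b c) (lift a d) oU sF) => // u _.
    by rewrite !mxE.
  by apply: smooth_eq => // u _; rewrite mxE.
by apply: smooth_eq => // u Uu; rewrite /invmx uF.
Qed.

Lemma derive_comp (V W W' : normedModType R) (f : V -> W) (g : W -> W') u v :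
  differentiable f u -> differentiable g (f u) ->
  'D_v (g \o f) u = 'D_('D_v f u) g (f u).
Proof.
move=> df dg; rewrite deriveE; last exact: differentiable_comp.
by rewrite diff_comp //= !deriveE.
Qed.

Lemma derive_dirZ (V W : normedModType R) (f : V -> W) u (a : R) v :
  differentiable f u -> 'D_(a *: v) f u = a *: 'D_v f u.
Proof. by move=> df; rewrite !deriveE // linearZ. Qed.

Lemma derive_dir_sum (V W : normedModType R) (f : V -> W) u (I : Type)
    (r : seq I) (v : I -> V) : differentiable f u ->
  'D_(\sum_(i <- r) v i) f u = \sum_(i <- r) 'D_(v i) f u.
Proof.
by move=> df; rewrite deriveE // linear_sum; apply: eq_bigr => i _; rewrite deriveE.
Qed.

Lemma derive_dir_delta p (V : normedModType R) (f : 'rV[R]_p -> V) u v :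
  differentiable f u -> 'D_v f u = \sum_a v 0 a *: 'D_(delta_mx 0 a) f u.
Proof.
move=> df; rewrite [v in LHS]row_sum_delta derive_dir_sum //.
by apply: eq_bigr => a _; rewrite derive_dirZ.
Qed.

(** The induction goes through the chain rule
    D_v (g o f) = sum_a (D_v f)_a (d_a g) o f. *)
Lemma Ck_comp k p (U' : set 'rV[R]_p) (g : 'rV[R]_p -> R^o)
    (f : 'rV[R]_m -> 'rV[R]_p) :
  (forall u, U u -> U' (f u)) -> smooth_on U f -> Ck k U' g ->
  Ck k U (fun u => g (f u)).
Proof.
move=> fU sf; elim: k g => [|k IH] g.
  move=> cg x Ux; apply: (@continuous_comp _ _ _ f g).
    by apply: differentiable_continuous; exact: smooth_differentiable sf Ux.
  exact/cg/fU.
case=> dg Dg; split=> [x Ux|v].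
  apply: (@differentiable_comp _ _ _ _ f g); last exact/dg/fU.
  exact: smooth_differentiable sf Ux.
have : Ck k U (fun u => \sum_a ('D_v f u) 0 a * ('D_(delta_mx 0 a) g) (f u) : R^o).
  apply: Ck_sum => // a; apply: (CkM oU); last exact: IH (Dg _).
  exact: (smooth_entry 0 a oU (smooth_derive v sf) k).
apply: Ck_eq => // u Uu; have dfu := smooth_differentiable sf Uu.
rewrite [RHS](derive_comp v dfu (dg _ (fU _ Uu))).
by rewrite [RHS]derive_dir_delta //; exact: dg (fU _ Uu).
Qed.

Lemma smooth_comp p q r (U' : set 'rV[R]_p) (G : 'rV[R]_p -> 'M[R]_(q, r))
    (f : 'rV[R]_m -> 'rV[R]_p) :
  open U' -> (forall u, U u -> U' (f u)) -> smooth_on U f -> smooth_on U' G ->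
  smooth_on U (fun u => G (f u)).
Proof.
move=> oU' fU sf sG; apply: smooth_entries => // a b k.
exact: (Ck_comp fU sf (smooth_entry a b oU' sG k)).
Qed.

Lemma smooth_comp_scalar p (U' : set 'rV[R]_p) (g : 'rV[R]_p -> R^o)
    (f : 'rV[R]_m -> 'rV[R]_p) :
  (forall u, U u -> U' (f u)) -> smooth_on U f -> smooth_on U' g ->
  smooth_on U (fun u => g (f u) : R^o).
Proof. by move=> fU sf sg k; exact: (Ck_comp fU sf (sg k)). Qed.

End SmoothBlocks.

(** ** Directional derivatives of matrix expressions *)

Section DeriveMatrices.
Variables (R : realType) (V : normedModType R) (u v : V).

Lemma is_derive_entries p q (F : V -> 'M[R]_(p, q)) dF :
  is_derive u v F dF <->
  forall a b, is_derive u v (fun w => F w a b : R^o) (dF a b).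
Proof.
split=> [[dF1 <-] a b|dF1].
  split; first exact: (derivable_mxP F u v).1.
  by rewrite derive_mx // mxE.
have dFv : derivable F u v.
  by apply/derivable_mxP => a b; have [] := dF1 a b.
split=> //; apply/matrixP => a b.
by rewrite derive_mx // mxE; have [_ <-] := dF1 a b.
Qed.

Lemma is_derive_mulmx p q r (F : V -> 'M[R]_(p, q)) (G : V -> 'M[R]_(q, r)) dF dG :
  is_derive u v F dF -> is_derive u v G dG ->
  is_derive u v (fun w => F w *m G w) (dF *m G u + F u *m dG).
Proof.
move=> /is_derive_entries hF /is_derive_entries hG.
apply/is_derive_entries => a b.
have -> : (fun w => (F w *m G w) a b : R^o) =
    \sum_(c < q) (fun w => F w a c * G w c b : R^o).
  by apply/funext => w; rewrite mxE fct_sumE.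
have h (c : 'I_q) : is_derive u v (fun w => F w a c * G w c b : R^o)
    (F u a c *: dG c b + G u c b *: dF a c).
  exact: (is_deriveM (hF a c) (hG c b)).
apply: (@is_derive_eq _ _ _ _ _ _ _ _ (is_derive_sum h)).
rewrite !mxE -big_split; apply: eq_bigr => c _ /=.
by rewrite addrC; congr (_ + _); rewrite mulrC.
Qed.

Lemma is_derive_mull p q r (C : 'M[R]_(p, q)) (F : V -> 'M[R]_(q, r)) dF :
  is_derive u v F dF -> is_derive u v (fun w => C *m F w) (C *m dF).
Proof.
move=> hF; have := is_derive_mulmx (is_derive_cst C u v) hF.
by rewrite mul0mx add0r.
Qed.

Lemma is_derive_mulr p q r (C : 'M[R]_(q, r)) (F : V -> 'M[R]_(p, q)) dF :
  is_derive u v F dF -> is_derive u v (fun w => F w *m C) (dF *m C).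
Proof.
move=> hF; have := is_derive_mulmx hF (is_derive_cst C u v).
by rewrite mulmx0 addr0.
Qed.

Lemma is_derive_trmx p q (F : V -> 'M[R]_(p, q)) dF :
  is_derive u v F dF -> is_derive u v (fun w => (F w)^T) dF^T.
Proof.
move=> /is_derive_entries hF; apply/is_derive_entries => a b.
have -> : (fun w => (F w)^T a b : R^o) = (fun w => F w b a).
  by apply/funext => w; rewrite mxE.
by rewrite mxE; exact: hF.
Qed.

Lemma is_derive_row_mx p q r (F : V -> 'M[R]_(p, q)) (G : V -> 'M[R]_(p, r)) dF dG :
  is_derive u v F dF -> is_derive u v G dG ->
  is_derive u v (fun w => row_mx (F w) (G w)) (row_mx dF dG).
Proof.
move=> /is_derive_entries hF /is_derive_entries hG; apply/is_derive_entries => a b.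
case: (split_ordP b) => c ->.
  rewrite row_mxEl; have -> : (fun w => row_mx (F w) (G w) a (lshift r c) : R^o)
      = (fun w => F w a c) by apply/funext => w; rewrite row_mxEl.
  exact: hF.
rewrite row_mxEr; have -> : (fun w => row_mx (F w) (G w) a (rshift q c) : R^o)
  = (fun w => G w a c) by apply/funext => w; rewrite row_mxEr.
exact: hG.
Qed.

Lemma is_derive_col_mx p q r (F : V -> 'M[R]_(p, q)) (G : V -> 'M[R]_(r, q)) dF dG :
  is_derive u v F dF -> is_derive u v G dG ->
  is_derive u v (fun w => col_mx (F w) (G w)) (col_mx dF dG).
Proof.
move=> /is_derive_trmx hF /is_derive_trmx hG.
have := is_derive_trmx (is_derive_row_mx hF hG).
rewrite tr_row_mx !trmxK; congr is_derive.
by apply/funext => w; rewrite tr_row_mx !trmxK.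
Qed.

Lemma is_derive_block_mx p q r s (A : V -> 'M[R]_(p, q)) (B : V -> 'M[R]_(p, r))
    (C : V -> 'M[R]_(s, q)) (E : V -> 'M[R]_(s, r)) dA dB dC dE :
  is_derive u v A dA -> is_derive u v B dB -> is_derive u v C dC ->
  is_derive u v E dE ->
  is_derive u v (fun w => block_mx (A w) (B w) (C w) (E w)) (block_mx dA dB dC dE).
Proof. by move=> *; apply: is_derive_col_mx; apply: is_derive_row_mx. Qed.

End DeriveMatrices.

(** * Charts, components and changes of coordinates *)

Lemma eq_mulmx_row (R : pzRingType) (m n : nat) (A B : 'M[R]_(m, n)) :
  (forall v : 'rV[R]_m, v *m A = v *m B) -> A = B.
Proof. by move=> AB; apply/row_matrixP => i; rewrite !rowE. Qed.

(** The Jacobian matrix of a change of charts, sealed so that the unifier never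
    unfolds it. *)
HB.lock Definition cjac (R : realType) (n : nat) (M : atlas R n) i j (x : M) :=
  jac i j x.

Section Charts.
Variables (R : realType) (n : nat) (M : atlas R n).
Hypothesis mfd : smooth_manifold M.
Implicit Types (i j c k : chart_index M) (x y : M) (W : set M) (u v : 'rV[R]_n).

Lemma dom_open c : open (dom c).
Proof. by case: mfd. Qed.

Lemma range_open c : open (phi c @` dom c).
Proof. by case: mfd. Qed.

Arguments dom_open c : clear implicits.
Arguments range_open c : clear implicits.

Lemma phiK c x : dom c x -> psi c (phi c x) = x.
Proof. by case: mfd => _ _ _ _ + _ _ _ _; apply. Qed.

Lemma mfd_transitionE i j :
  smooth_on (phi i @` (dom i `&` dom j)) (phi j \o psi i).
Proof. by case: mfd. Qed.

Lemma img_phi W c x : W x -> dom c x -> (phi c @` (W `&` dom c)) (phi c x).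
Proof. by exists x. Qed.

Lemma img_psi W c u : (phi c @` (W `&` dom c)) u ->
  [/\ W (psi c u), dom c (psi c u) & phi c (psi c u) = u].
Proof. by move=> [x [Wx dx] <-]; rewrite phiK. Qed.

Lemma img_open W c : open W -> open (phi c @` (W `&` dom c)).
Proof.
move=> oW; have oc := range_open c.
have := mfd_psi_cont mfd (i := c); rewrite continuous_open_subspace //.
move=> /(continuous_inP _ oc) /(_ W oW).
congr open; apply/seteqP; split=> u.
  by move=> [[x dx <-]]; rewrite /preimage/= phiK // => Wx; exists x.
by move=> [x [Wx dx] <-]; split; [exists x|rewrite /preimage/= phiK].
Qed.

Arguments img_open {W} c _.

Lemma near_psi W c x : open W -> W x -> dom c x ->
  \forall u \near phi c x, (phi c @` (W `&` dom c)) u.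
Proof. by move=> oW Wx dx; apply: (near_open (img_open c oW) (img_phi Wx dx)). Qed.

Lemma transition_smooth i j :
  smooth_on (phi j @` (dom i `&` dom j)) (phi i \o psi j).
Proof. by rewrite setIC; exact: mfd_transitionE. Qed.

Lemma transition_differentiable i j x : dom i x -> dom j x ->
  differentiable (phi j \o psi i) (phi i x).
Proof.
move=> di dj; apply: (smooth_differentiable (mfd_transitionE i j)).
by exists x.
Qed.

Lemma mul_jac i j x v : dom i x -> dom j x ->
  v *m cjac i j x = 'D_v (phi j \o psi i) (phi i x).
Proof.
move=> di dj; rewrite cjac.unlock deriveEjacobian //.
exact: transition_differentiable.
Qed.

Lemma jac_cocycle i j k x : dom i x -> dom j x -> dom k x ->
  cjac i j x *m cjac j k x = cjac i k x.
Proof.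
move=> di dj dk; apply: eq_mulmx_row => v.
have phij : phi j x = (phi j \o psi i) (phi i x) by rewrite /= phiK.
have dg : differentiable (phi k \o psi j) ((phi j \o psi i) (phi i x)).
  by rewrite -phij; exact: transition_differentiable.
rewrite mulmxA.
rewrite (mul_jac _ di dk).
rewrite (mul_jac v di dj).
rewrite (mul_jac _ dj dk).
have := derive_comp v (transition_differentiable di dj) dg.
rewrite -phij => <-.
apply: near_eq_derive.
apply: filterS (near_psi (dom_open j) dj di) => u /img_psi[dju diu e] /=.
by rewrite phiK.
Qed.

Lemma jac_id i x : dom i x -> cjac i i x = 1%:M.
Proof.
move=> di; apply: eq_mulmx_row => v; rewrite mul_jac // mulmx1.
rewrite -[RHS](derive_id (phi i x)); apply: near_eq_derive.
by apply: filterS (near_psi (dom_open i) di di) => u /img_psi[].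
Qed.

Lemma jacK i j x : dom i x -> dom j x -> cjac i j x *m cjac j i x = 1%:M.
Proof. by move=> di dj; rewrite jac_cocycle // jac_id. Qed.

Lemma jac_unit i j x : dom i x -> dom j x -> cjac i j x \in unitmx.
Proof. by move=> di dj; case: (mulmx1_unit (jacK di dj)). Qed.

Lemma jac_smooth i j :
  smooth_on (phi i @` (dom j `&` dom i)) (fun u => cjac i j (psi i u)).
Proof.
have oO : open (phi i @` (dom j `&` dom i)) by apply: img_open (dom_open j).
apply: smooth_entries => // a b.
have st : smooth_on (phi i @` (dom j `&` dom i)) (phi j \o psi i).
  exact: transition_smooth.
have := smooth_entry 0 b oO (smooth_derive (delta_mx 0 a) st).
apply: smooth_eq => // u /img_psi[dj di e].
by rewrite -{1}e -mul_jac // -rowE mxE.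
Qed.

(** The same Jacobian, seen as a function of the coordinates of a third chart. *)
Lemma jac_smooth_in c i j :
  smooth_on (phi c @` (dom i `&` dom j `&` dom c)) (fun u => cjac i j (psi c u)).
Proof.
have oij : open (dom i `&` dom j) by apply: openI; exact: dom_open.
have oO := img_open c oij.
have oi := img_open i (dom_open j).
have : smooth_on (phi c @` (dom i `&` dom j `&` dom c))
    (fun u => cjac i j (psi i ((phi i \o psi c) u))).
  apply: (smooth_comp oO oi _ _ (@jac_smooth i j)).
    by move=> u /img_psi[[di dj] dc _]; exact: img_phi.
  apply: smooth_subset (transition_smooth i c) => u [x [[di dj] dc] <-].
  exact: img_phi.
apply: smooth_eq => // u /img_psi[[di dj] dc _] /=.
by rewrite phiK.
Qed.

Lemma dom_ch x : dom (ch x) x. Proof. exact: mfd_ch. Qed.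

(** [X x] is given in the distinguished chart [ch x]. *)
Lemma componentsE c (X : vfield M) x : dom c x ->
  components c X (phi c x) = X x *m cjac (ch x) c x.
Proof. by move=> dc; rewrite /components cjac.unlock phiK. Qed.

Lemma components_chart i j (X : vfield M) x : dom i x -> dom j x ->
  components j X (phi j x) = components i X (phi i x) *m cjac i j x.
Proof.
move=> di dj; rewrite !componentsE // -mulmxA jac_cocycle //; exact: dom_ch.
Qed.

Lemma jac_ch x : cjac (ch x) (ch x) x = 1%:M.
Proof. by apply: jac_id; exact: dom_ch. Qed.

Lemma components_ch (X : vfield M) x : components (ch x) X (phi (ch x) x) = X x.
Proof. by rewrite componentsE ?jac_ch ?mulmx1 //; exact: dom_ch. Qed.

(** Inside the domain of one chart, smoothness can be tested in that chart. *)
Lemma smooth_vf_chart W c (X : vfield M) : open W -> W `<=` dom c ->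
  smooth_on (phi c @` (W `&` dom c)) (components c X) -> smooth_vf W X.
Proof.
move=> oW Wc sX i.
have oO := img_open i oW; have oc := img_open c oW.
have : smooth_on (phi i @` (W `&` dom i))
    (fun u => components c X ((phi c \o psi i) u) *m cjac c i (psi i u)).
  apply: (smooth_mulmx oO).
    apply: (smooth_comp oO oc _ _ sX).
      by move=> u /img_psi[Wx di _]; apply: img_phi => //; apply: Wc.
    apply: smooth_subset (transition_smooth c i) => u [x [Wx di] <-].
    by apply: img_phi => //; apply: Wc.
  apply: smooth_subset (@jac_smooth_in i c i).
  by move=> u [x [Wx di] <-]; apply: img_phi => //; split=> //; apply: Wc.
apply: smooth_eq => // u /img_psi[Wx di e] /=.
by rewrite -[u in RHS]e -components_chart //; apply: Wc.
Qed.

Lemma smooth_fun_chart W c (f : M -> R) : open W -> W `<=` dom c ->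
  smooth_on (phi c @` (W `&` dom c)) (f \o psi c : _ -> R^o) -> smooth_fun W f.
Proof.
move=> oW Wc sf i.
have oO := img_open i oW; have oc := img_open c oW.
have : smooth_on (phi i @` (W `&` dom i))
    (fun u => (f \o psi c) ((phi c \o psi i) u) : R^o).
  apply: (smooth_comp_scalar oO _ _ sf).
    by move=> u /img_psi[Wx di _]; apply: img_phi => //; apply: Wc.
  apply: smooth_subset (transition_smooth c i) => u [x [Wx di] <-].
  by apply: img_phi => //; apply: Wc.
apply: smooth_eq => // u /img_psi[Wx di e] /=.
by rewrite phiK //; apply: Wc.
Qed.

Lemma smooth_vf_subset W W' (X : vfield M) : W' `<=` W ->
  smooth_vf W X -> smooth_vf W' X.
Proof.
move=> sW sX i; apply: smooth_subset (sX i) => u [x [Wx di] <-].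
by apply: img_phi => //; apply: sW.
Qed.

(** The vector field on the domain of chart [c] with constant components [v]. *)
Definition const_vf c v : vfield M := fun x => v *m cjac c (ch x) x.

Lemma coord_vfE c a : coord_vf c a = const_vf c (ebase R a).
Proof. by apply/funext => x; rewrite /const_vf cjac.unlock. Qed.

Lemma const_vf_ch x v : const_vf (ch x) v x = v.
Proof. by rewrite /const_vf jac_ch mulmx1. Qed.

Lemma components_const_vf c v x : dom c x ->
  components c (const_vf c v) (phi c x) = v.
Proof.
move=> dc; rewrite componentsE // /const_vf -mulmxA jacK ?mulmx1 //.
exact: dom_ch.
Qed.

Lemma const_vf_smooth c v : smooth_vf (dom c) (const_vf c v).
Proof.
have oc := dom_open c; have oO := img_open c oc.
apply: (smooth_vf_chart oc (c := c)) => //.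
apply: (smooth_eq oO _ (smooth_cst _ v)) => u /img_psi[_ dc <-].
by rewrite components_const_vf.
Qed.

Lemma coord_vf_smooth c a : smooth_vf (dom c) (coord_vf c a).
Proof. by rewrite coord_vfE; exact: const_vf_smooth. Qed.

Lemma derive_components_const_vf x v w :
  'D_w (components (ch x) (const_vf (ch x) v)) (phi (ch x) x) = 0.
Proof.
rewrite -[RHS](derive_cst v (phi (ch x) x) w); apply: near_eq_derive.
have dx := dom_ch x.
apply: filterS (near_psi (dom_open (ch x)) dx dx) => u /img_psi[_ du e].
by rewrite -[u]e components_const_vf.
Qed.

Lemma lie_const_vf x v w : lie (const_vf (ch x) v) (const_vf (ch x) w) x = 0.
Proof. by rewrite /lie !derive_components_const_vf subrr. Qed.

Lemma const_vf_sum c v x : const_vf c v x = \sum_a v 0 a *: coord_vf c a x.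
Proof.
rewrite /const_vf [v in LHS]row_sum_delta mulmx_suml.
by apply: eq_bigr => a _; rewrite coord_vfE /const_vf -scalemxAl.
Qed.

Lemma comp_fun_smooth W c (X : vfield M) a : open W -> W `<=` dom c ->
  smooth_vf W X -> smooth_fun W (fun x => components c X (phi c x) 0 a).
Proof.
move=> oW Wc sX; apply: (@smooth_fun_chart _ c) => //.
have oO := img_open c oW.
have h : smooth_on (phi c @` (W `&` dom c)) (fun u => components c X u 0 a : R^o).
  exact: (smooth_entry 0 a oO (sX c)).
by apply: (smooth_eq oO _ h) => u /img_psi[_ _ e]; rewrite /= e.
Qed.

Lemma vfield_coord_sum c (X : vfield M) x : dom c x ->
  X x = \sum_a components c X (phi c x) 0 a *: coord_vf c a x.
Proof.
move=> dc; rewrite -const_vf_sum /const_vf componentsE //.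
by rewrite -mulmxA jacK ?mulmx1 //; exact: dom_ch.
Qed.

End Charts.

Arguments dom_open {R n M} mfd c.
Arguments range_open {R n M} mfd c.
Arguments img_open {R n M} mfd {W} c _.

(** * The cotangent bundle is a smooth manifold *)

Section RationalBalls.
Variables (R : realType) (m : nat).

Lemma rational_ball (u : 'rV[R]_m) (e : R) : 0 < e ->
  exists (q : 'rV[rat]_m) (k : nat),
    ball (map_mx ratr q : 'rV[R]_m) (k.+1%:R^-1) u /\
    ball (map_mx ratr q : 'rV[R]_m) (k.+1%:R^-1) `<=` ball u e.
Proof.
move=> e0.
(* Two radii 1/(k+1) must fit into e. *)
have [k] := ltr_add_invr (divr_gt0 e0 (ltr0n R 2)); rewrite add0r => ke.
have k0 : 0 < k.+1%:R^-1 :> R by rewrite invr_gt0 ltr0n.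
have /choice[q hq] : forall a : 'I_m, exists q : rat,
    ball (ratr q : R) (k.+1%:R^-1) (u 0 a).
  move=> a; have ltk : u 0 a < u 0 a + k.+1%:R^-1 by rewrite ltrDl.
  have [q /itvP qu] := rat_in_itvoo ltk.
  exists q; rewrite /ball /= gtr0_norm ?subr_gt0 ?qu //.
  by rewrite ltrBlDl qu.
exists (\row_a q a), k.
have bu : ball (map_mx ratr (\row_a q a) : 'rV[R]_m) (k.+1%:R^-1) u.
  by split=> // b a; rewrite ord1 !mxE; exact: hq.
split=> // w bw; apply: (le_ball (ltW (_ : k.+1%:R^-1 + k.+1%:R^-1 < e))).
  by rewrite (splitr e) ltrD.
by apply: ball_triangle bw; apply: ball_sym.
Qed.

End RationalBalls.

Section CotangentManifold.
Variables (R : realType) (n : nat) (M : atlas R n).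
Hypothesis mfd : smooth_manifold M.
Implicit Types (i j c : chart_index M) (x : M) (W : set M).
Implicit Types (u : 'rV[R]_(n + n)) (p : cotangent_space M).

Lemma cot_phiE i p :
  cot_phi i p = row_mx (phi i (base p))
                       (fiber p *m (cjac i (ch (base p)) (base p))^T).
Proof. by rewrite cjac.unlock. Qed.

Lemma cot_psiE i u : cot_psi i u = Covector (psi i (lsubmx u))
  (rsubmx u *m (cjac (ch (psi i (lsubmx u))) i (psi i (lsubmx u)))^T).
Proof. by rewrite cjac.unlock. Qed.

Lemma cot_phiK i p : dom i (base p) -> cot_psi i (cot_phi i p) = p.
Proof.
move=> di; rewrite cot_psiE cot_phiE row_mxKl row_mxKr (phiK mfd) //.
rewrite -mulmxA -trmx_mul (jacK mfd) // ?trmx1 ?mulmx1; first by case: p di.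
exact: dom_ch.
Qed.

Lemma cot_psiK i u : (phi i @` dom i) (lsubmx u) -> cot_phi i (cot_psi i u) = u.
Proof.
case=> x di xu; rewrite cot_phiE cot_psiE /= -xu (phiK mfd) //.
rewrite -mulmxA -trmx_mul (jacK mfd) // ?trmx1 ?mulmx1 ?xu ?hsubmxK //.
exact: dom_ch.
Qed.

Lemma cot_imgE W i :
  cot_phi i @` ((@base R n M) @^-1` W `&` cot_dom i) =
  [set u | (phi i @` (W `&` dom i)) (lsubmx u)].
Proof.
apply/seteqP; split=> u.
  by move=> [p [Wp dp] <-]; rewrite /= cot_phiE row_mxKl; exists (base p).
move=> /= iu; have [Wx dx e] := img_psi mfd iu.
exists (cot_psi i u); last by apply: cot_psiK; rewrite -e; exists (psi i (lsubmx u)).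
by rewrite cot_psiE; split.
Qed.

Lemma cot_rangeE i : cot_phi i @` cot_dom i = [set u | (phi i @` dom i) (lsubmx u)].
Proof. by have := cot_imgE setT i; rewrite preimage_setT !setTI. Qed.

Lemma lsubmx_preimage_open (O : set 'rV[R]_n) : open O ->
  open [set u : 'rV[R]_(n + n) | O (lsubmx u)].
Proof.
move=> oO; apply: (@open_comp _ _ (lsubmx : 'rV[R]_(n + n) -> 'rV[R]_n)) => // u _.
exact: continuous_lsubmx.
Qed.

Lemma cot_transitionE i j u : (phi i @` (dom i `&` dom j)) (lsubmx u) ->
  (cot_phi j \o cot_psi i) u =
  row_mx ((phi j \o psi i) (lsubmx u))
         (rsubmx u *m (cjac j i (psi i (lsubmx u)))^T).
Proof.
move=> [x [di dj] xu]; rewrite /= cot_phiE cot_psiE /= -xu (phiK mfd) //.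
by rewrite -mulmxA -trmx_mul (jac_cocycle mfd) //; exact: dom_ch.
Qed.

Lemma cot_transition_smooth i j :
  smooth_on [set u | (phi i @` (dom i `&` dom j)) (lsubmx u)]
    (cot_phi j \o cot_psi i).
Proof.
set O := phi i @` (dom i `&` dom j).
have oO : open O by rewrite /O setIC; exact: img_open (dom_open mfd j).
have oU := lsubmx_preimage_open oO.
have sl : smooth_on [set u | O (lsubmx u)] (fun u => lsubmx u).
  exact: (smooth_lsubmx oU (smooth_id oU)).
have sr : smooth_on [set u | O (lsubmx u)] (fun u => rsubmx u).
  exact: (smooth_rsubmx oU (smooth_id oU)).
have h : smooth_on [set u | O (lsubmx u)]
    (fun u => row_mx ((phi j \o psi i) (lsubmx u))
         (rsubmx u *m (cjac j i (psi i (lsubmx u)))^T)).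
  apply: (smooth_row_mx oU).
    apply: (smooth_comp oU oO _ sl (mfd_transitionE mfd i j)) => u.
    exact.
  apply: (smooth_mulmx oU sr); apply: (smooth_trmx oU).
  apply: (smooth_comp oU oO (G := fun w => cjac j i (psi i w)) _ sl) => //.
  apply: smooth_subset (jac_smooth_in mfd i j i).
  by move=> u [x [di dj] <-]; apply: img_phi.
by apply: (smooth_eq oU _ h) => u Ou; rewrite cot_transitionE.
Qed.

(** The open sets are those that are open in every chart. *)
Lemma open_cotE (O : set (cotangent_space M)) : open O = cot_open O.
Proof. by []. Qed.

Lemma base_open W : open W -> open ((@base R n M) @^-1` W : set (cotangent_space M)).
Proof.
move=> oW; rewrite open_cotE => i u iu /= Wu.
have [x dx e] := iu; have Wx : W x by move: Wu; rewrite -e (phiK mfd).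
have oU := lsubmx_preimage_open (img_open mfd i oW).
apply: (near_open oU) => [|u' [y [Wy dy] yu] _] /=.
  by rewrite /= -e; exact: img_phi.
by rewrite -yu (phiK mfd).
Qed.

Lemma cot_dom_open i : open (cot_dom i).
Proof. exact: base_open (dom_open mfd i). Qed.

Lemma cot_range_open i : open (cot_phi i @` cot_dom i).
Proof. by rewrite cot_rangeE; exact: lsubmx_preimage_open (range_open mfd i). Qed.

Lemma cot_phi_cont i : {within cot_dom i, continuous (cot_phi i)}.
Proof.
have od : open (cot_dom i) by exact: cot_dom_open.
rewrite continuous_open_subspace //; apply/(continuous_inP _ od) => X oX.
rewrite open_cotE => j u ju; rewrite cot_psiE => -[/= di]; rewrite -cot_psiE => Xu.
have iu : (phi j @` (dom j `&` dom i)) (lsubmx u).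
  have [x dx e] := ju; rewrite -e; exists x => //; split=> //.
  by move: di; rewrite /cot_dom /= -e (phiK mfd).
have oO : open [set u : 'rV[R]_(n + n) | (phi j @` (dom j `&` dom i)) (lsubmx u)].
  by apply: lsubmx_preimage_open; rewrite setIC; exact: img_open (dom_open mfd i).
have cf : {for u, continuous (cot_phi i \o cot_psi j)}.
  apply: differentiable_continuous.
  exact: (smooth_differentiable (cot_transition_smooth j i)).
have nX : nbhs u ((cot_phi i \o cot_psi j) @^-1` X).
  by apply: cf; apply: open_nbhs_nbhs.
have nO : nbhs u [set u : 'rV[R]_(n + n) | (phi j @` (dom j `&` dom i)) (lsubmx u)].
  exact: open_nbhs_nbhs.
apply: filterS2 nX nO => u' Xu' [y [dj di'] yu'] _; split=> //.
by rewrite cot_psiE /cot_dom /= -yu' (phiK mfd).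
Qed.

Lemma cot_psi_cont i : {within cot_phi i @` cot_dom i, continuous (cot_psi i)}.
Proof.
have or : open (cot_phi i @` cot_dom i) by exact: cot_range_open.
rewrite continuous_open_subspace //; apply/(continuous_inP _ or) => X oX.
rewrite openE => u [ru Xu]; rewrite /interior.
have iu : (phi i @` dom i) (lsubmx u) by move: ru; rewrite cot_rangeE.
move: oX; rewrite open_cotE => oX; have nX := oX i u iu Xu.
have nr : nbhs u (cot_phi i @` cot_dom i) by exact: open_nbhs_nbhs.
apply: filterS2 nX nr => u' Xu' ru'; split; [exact: ru'|apply: Xu'].
by move: ru'; rewrite cot_rangeE.
Qed.

Lemma cot_phi_open i (X : set 'rV[R]_(n + n)) : open X ->
  open (cot_dom i `&` cot_phi i @^-1` X).
Proof.
have od : open (cot_dom i) by exact: cot_dom_open.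
have := cot_phi_cont (i := i).
by rewrite continuous_open_subspace // => /(continuous_inP _ od); apply.
Qed.

Lemma cot_hausdorff : hausdorff_space (cotangent_space M).
Proof.
rewrite open_hausdorff => p q pq.
have [epq|npq] := pselect (base p = base q); last first.
  have := mfd_hausdorff mfd; rewrite open_hausdorff => /(_ (base p) (base q)).
  case=> [|[A B] [/= pA qB] [oA oB /eqP AB]]; first exact/eqP.
  exists (@base R n M @^-1` A, @base R n M @^-1` B) => /=.
    by move: pA qB; rewrite !inE.
  split; [exact: base_open|exact: base_open|].
  by apply/eqP; rewrite -preimage_setI AB preimage_set0.
set i := ch (base p).
have dp : dom i (base p) by exact: dom_ch.
have dq : dom i (base q) by rewrite -epq.
have nphi : cot_phi i p != cot_phi i q.
  apply: contra_neq pq => e.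
  by rewrite -(cot_phiK dp) -(cot_phiK dq) e.
have := @norm_hausdorff R 'rV[R]_(n + n); rewrite open_hausdorff.
move=> /(_ _ _ nphi) [[A B] [/= pA qB] [oA oB /eqP AB]].
exists (cot_dom i `&` cot_phi i @^-1` A, cot_dom i `&` cot_phi i @^-1` B) => /=.
  by move: pA qB; rewrite !inE.
split; [exact: cot_phi_open|exact: cot_phi_open|].
by apply/eqP; rewrite setIACA -preimage_setI AB preimage_set0 setI0.
Qed.

(** Some chart whose domain contains a given set. *)
Let chart_over W : option (chart_index M) :=
  if pselect (exists i, W `<=` dom i) is left h then Some (projT1 (cid h))
  else None.

Let chart_over_sub W i : chart_over W = Some i -> W `<=` dom i.
Proof. by rewrite /chart_over; case: pselect => // h [<-]; case: (cid h). Qed.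

Let chart_over_exists W i : W `<=` dom i -> exists j, chart_over W = Some j.
Proof.
move=> Wi; rewrite /chart_over; case: pselect => [h|[]]; last by exists i.
by exists (projT1 (cid h)).
Qed.

(** A basic open set: covectors over [W] whose coordinates, in the chosen chart
    containing [W], lie in a ball with rational centre. *)
Let cot_box W (t : 'rV[rat]_(n + n) * nat) : set (cotangent_space M) :=
  [set p | W (base p) /\
    if chart_over W is Some i then
      ball (map_mx ratr t.1 : 'rV[R]_(n + n)) (t.2.+1%:R^-1) (cot_phi i p)
    else False].

Let cot_box_open W t : open W -> open (cot_box W t).
Proof.
move=> oW; rewrite /cot_box; case e : (chart_over W) => [i|]; last first.
  have -> : [set p | W (base p) /\ False] = set0 :> set (cotangent_space M).
    by apply/seteqP; split=> // p [].
  exact: open0.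
have Wi := chart_over_sub e.
have := openI (base_open oW)
  (@cot_phi_open i _ (ball_open (map_mx ratr t.1 : 'rV[R]_(n + n))
    (t.2.+1%:R^-1))).
congr open; apply/seteqP; split=> p [Wp].
  by move=> [].
by move=> bp; split; [exact: Wp|split; [exact: Wi Wp|exact: bp]].
Qed.

Lemma cot_second_countable : @second_countable (cotangent_space M).
Proof.
have [B cB [oB bB]] := mfd_second_countable mfd.
exists (\bigcup_(V in B) \bigcup_(t in setT) [set cot_box V t]).
  apply: bigcup_countable => // V _.
  apply: bigcup_countable => [|t _]; first exact: countableP.
  exact: countable1.
split; first by move=> Q [V BV [t _ ->]]; apply: cot_box_open; exact: oB.
move=> p A nA; have : nbhs p A by exact: nA.
rewrite nbhsE => -[Q [oQ Qp] QA].
have [V [BV Vp] Vd] : filter_from [set U | B U /\ U (base p)] id (dom (ch (base p))).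
  by apply: bB; apply: open_nbhs_nbhs; split; [exact: dom_open|exact: dom_ch].
have [i ei] := chart_over_exists Vd; have Vi := chart_over_sub ei.
have di := Vi _ Vp.
have iu : (phi i @` dom i) (lsubmx (cot_phi i p)).
  by rewrite cot_phiE row_mxKl; exists (base p).
move: (oQ); rewrite open_cotE => /(_ i (cot_phi i p) iu).
rewrite cot_phiK // => /(_ Qp)/nbhs_ballP[e /= e0 eQ].
have [q [k [bp bs]]] := rational_ball (cot_phi i p) e0.
exists (cot_box V (q, k)).
  split; first by exists V => //; exists (q, k).
  by rewrite /cot_box ei; split.
move=> p' [Vp']; rewrite ei => bp'.
apply: QA; have dp' := Vi _ Vp'.
rewrite -(cot_phiK dp'); apply: eQ; first exact: bs.
by rewrite cot_phiE row_mxKl; exists (base p').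
Qed.

Lemma cotangent_manifold : smooth_manifold (cotangent M).
Proof.
split.
- exact: cot_hausdorff.
- exact: cot_second_countable.
- exact: cot_dom_open.
- exact: cot_range_open.
- by move=> i p /cot_phiK.
- exact: cot_phi_cont.
- exact: cot_psi_cont.
- move=> i j; have := cot_transition_smooth i j.
  apply: smooth_subset => u [p [di dj] <-] /=.
  by rewrite cot_phiE row_mxKl; exists (base p).
- by move=> p; exact: (dom_ch mfd (base p)).
Qed.

End CotangentManifold.

(** * Local expressions of tensors and connections *)

Lemma mul_lin1_mx (R : pzRingType) (m p : nat) (f : 'rV[R]_m -> 'rV[R]_p) v :
  linear f -> v *m lin1_mx f = f v.
Proof.
move=> lf; pose fM := GRing.isLinear.Build _ _ _ _ f lf.
pose F : {linear 'rV[R]_m -> 'rV[R]_p} := HB.pack f fM.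
exact: (mul_rV_lin1 F).
Qed.

Section LocalFields.
Variables (R : realType) (n : nat) (M : atlas R n).
Hypothesis mfd : smooth_manifold M.
Implicit Types (c : chart_index M) (x y : M) (W : set M).
Implicit Types (v w z : 'rV[R]_n) (X Y Z : vfield M).

Lemma componentsD c X Y u :
  components c (fun y => X y + Y y) u = components c X u + components c Y u.
Proof. by rewrite /components mulmxDl. Qed.

Lemma componentsZ c (f : M -> R) X u :
  components c (fun y => f y *: X y) u = f (psi c u) *: components c X u.
Proof. by rewrite /components -scalemxAl. Qed.

Lemma smooth_vfD W X Y : open W -> smooth_vf W X -> smooth_vf W Y ->
  smooth_vf W (fun y => X y + Y y).
Proof.
move=> oW sX sY c; have oO := img_open mfd c oW.
by apply: (smooth_eq oO _ (smoothD oO (sX c) (sY c))) => u _; rewrite componentsD.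
Qed.

Lemma smooth_vfZ W (f : M -> R) X : open W -> smooth_fun W f -> smooth_vf W X ->
  smooth_vf W (fun y => f y *: X y).
Proof.
move=> oW sf sX c; have oO := img_open mfd c oW.
apply: (smooth_eq oO _ (smooth_scalemx oO (sf c) (sX c))) => u _.
by rewrite componentsZ.
Qed.

Lemma smooth_vf0 W : open W -> smooth_vf W (fun=> 0).
Proof.
move=> oW c; have oO := img_open mfd c oW.
by apply: (smooth_eq oO _ (smooth_cst _ 0)) => u _; rewrite /components mul0mx.
Qed.

Lemma smooth_vf_sum W (I : Type) (r : seq I) (Y : I -> vfield M) : open W ->
  (forall i, smooth_vf W (Y i)) -> smooth_vf W (fun y => \sum_(i <- r) Y i y).
Proof.
move=> oW sY; elim: r => [|i r IH].
  have -> : (fun y => \sum_(i <- [::]) Y i y) = fun=> 0.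
    by apply/funext => y; rewrite big_nil.
  exact: smooth_vf0.
have -> : (fun y => \sum_(i <- i :: r) Y i y) =
    fun y => Y i y + \sum_(i <- r) Y i y.
  by apply/funext => y; rewrite big_cons.
exact: smooth_vfD.
Qed.

Lemma smooth_fun_cst W (a : R) : smooth_fun W (fun=> a).
Proof. by move=> c; exact: smooth_cst. Qed.

Lemma dirder_cst x v (a : R) : dirder x v (fun=> a) = 0.
Proof. by rewrite /dirder; exact: (derive_cst (a : R^o)). Qed.

Section Connection.
Variable D : connection M.
Hypothesis cD : linear_connection D.

Lemma connection0 x v : D x v (fun=> 0) = 0.
Proof.
have s0 := smooth_vf0 openT.
have /= := con_add cD openT s0 s0 v (I : [set: M] x).
have -> : (fun _ : M => 0 + 0 : 'rV[R]_n) = fun=> 0.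
  by apply/funext => y; rewrite addr0.
by move=> /eqP; rewrite -subr_eq subrr eq_sym => /eqP.
Qed.

Lemma connectionZ W (a : R) Y x v : open W -> smooth_vf W Y -> W x ->
  D x v (fun y => a *: Y y) = a *: D x v Y.
Proof.
move=> oW sY Wx.
by rewrite (con_leibniz cD oW (smooth_fun_cst W a) sY) // dirder_cst scale0r add0r.
Qed.

Lemma connection_sum W (I : Type) (r : seq I) (f : I -> M -> R)
    (Y : I -> vfield M) x v : open W -> W x ->
  (forall i, smooth_fun W (f i)) -> (forall i, smooth_vf W (Y i)) ->
  D x v (fun y => \sum_(i <- r) f i y *: Y i y) =
  \sum_(i <- r) (dirder x v (f i) *: Y i x + f i x *: D x v (Y i)).
Proof.
move=> oW Wx sf sY; elim: r => [|i r IH].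
  rewrite big_nil -[RHS](connection0 x v); congr (D x v _).
  by apply/funext => y; rewrite big_nil.
rewrite big_cons -IH -(con_leibniz cD oW) //.
rewrite -(con_add cD oW) //; last 2 first.
- exact: smooth_vfZ.
- by apply: smooth_vf_sum => // k; exact: smooth_vfZ.
by congr (D x v _); apply/funext => y; rewrite big_cons.
Qed.

Lemma connection_linear W Y x : open W -> smooth_vf W Y -> W x ->
  linear (fun v => D x v Y).
Proof. by move=> oW sY Wx; exact: (con_linear cD oW sY Wx). Qed.

Lemma connection_dir_sum W Y x (I : Type) (r : seq I) (a : I -> R)
    (v : I -> 'rV[R]_n) : open W -> smooth_vf W Y -> W x ->
  D x (\sum_(i <- r) a i *: v i) Y = \sum_(i <- r) a i *: D x (v i) Y.
Proof.
move=> oW sY Wx; have lD := connection_linear oW sY Wx.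
elim: r => [|i r IH]; last by rewrite !big_cons lD IH.
rewrite !big_nil; have := lD (-1) 0 0.
by rewrite scaler0 addr0 scaleN1r addNr.
Qed.

Lemma connection_dir0 W Y x : open W -> smooth_vf W Y -> W x -> D x 0 Y = 0.
Proof.
move=> oW sY Wx; have := connection_linear oW sY Wx (-1) 0 0.
by rewrite scaler0 addr0 scaleN1r addNr.
Qed.

(** The connection matrix in chart [c]: [gamma c x v] is the matrix, acting on
    rows, of the Christoffel symbols contracted with the direction [v]. *)
Definition gamma c x v : 'M[R]_n :=
  \matrix_(l, k) \sum_a v 0 a * christoffel D c x k a l.

Lemma christoffelE c x k a l : dom c x ->
  christoffel D c x k a l =
  (cov D (coord_vf c a) (coord_vf c l) x *m cjac (ch x) c x) 0 k.
Proof. by rewrite cjac.unlock. Qed.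

Lemma cov_coord_vf c x v l : dom c x ->
  D x (const_vf c v x) (coord_vf c l) *m cjac (ch x) c x = row l (gamma c x v).
Proof.
move=> dc; rewrite const_vf_sum.
rewrite (connection_dir_sum _ _ _ (dom_open mfd c) (coord_vf_smooth mfd c l)) //.
apply/rowP => k; rewrite mulmx_suml summxE !mxE; apply: eq_bigr => a _.
by rewrite -scalemxAl mxE christoffelE.
Qed.

Lemma connection_const_vf c x v w : dom c x ->
  D x v (const_vf c w) = \sum_l w 0 l *: D x v (coord_vf c l).
Proof.
move=> dc.
have -> : const_vf c w = fun y => \sum_l w 0 l *: coord_vf c l y.
  by apply/funext => y; rewrite const_vf_sum.
rewrite (connection_sum _ v (dom_open mfd c) dc (f := fun l _ => w 0 l)).
- by apply: eq_bigr => l _; rewrite dirder_cst scale0r add0r.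
- by move=> l; exact: smooth_fun_cst.
- by move=> l; exact: coord_vf_smooth.
Qed.

Lemma cov_const_vf c x v w : dom c x ->
  cov D (const_vf c v) (const_vf c w) x *m cjac (ch x) c x = w *m gamma c x v.
Proof.
move=> dc; rewrite /cov connection_const_vf // mulmx_suml mulmx_sum_row.
by apply: eq_bigr => l _; rewrite -scalemxAl cov_coord_vf.
Qed.

(** D_v Y = d_v Y + Y Gamma_v in the distinguished chart: expand Y in the
    coordinate frame and use the Leibniz rule. *)
Lemma connectionE W Y x v : open W -> smooth_vf W Y -> W x ->
  D x v Y = 'D_v (components (ch x) Y) (phi (ch x) x) + Y x *m gamma (ch x) x v.
Proof.
move=> oW sY Wx; set c := ch x.
have dx : dom c x := dom_ch mfd x.
have oWc : open (W `&` dom c) := openI oW (dom_open mfd c).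
have Wcx : (W `&` dom c) x by [].
have sWc : W `&` dom c `<=` dom c by move=> ? [].
have sY' : smooth_vf (W `&` dom c) Y by apply: smooth_vf_subset sY => y [].
rewrite (con_local cD oWc sY' (Y' := fun y => \sum_l
  components c Y (phi c y) 0 l *: coord_vf c l y) _ _ Wcx); last first.
  by move=> y [_ dy]; exact: vfield_coord_sum.
rewrite (connection_sum _ v oWc Wcx (f := fun l y => components c Y (phi c y) 0 l)).
- rewrite big_split /=; congr (_ + _).
    rewrite [RHS]row_sum_delta; apply: eq_bigr => l _; congr (_ *: _).
      have dY : derivable (components c Y) (phi c x) v.
        by apply: smooth_derivable (sY c) _; exists x.
      rewrite (derive_entry _ _ dY); apply: near_eq_derive.
      apply: filterS (near_psi mfd oW Wx dx) => u /(img_psi mfd)[_ _ e] /=.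
      by rewrite e.
    by rewrite coord_vfE (const_vf_ch mfd).
  rewrite mulmx_sum_row; apply: eq_bigr => l _; congr (_ *: _).
    by rewrite (components_ch mfd).
  have := cov_coord_vf v l dx; rewrite (const_vf_ch mfd).
  by rewrite (jac_ch mfd) mulmx1.
- by move=> l; exact: (comp_fun_smooth mfd l oWc sWc sY').
- move=> l; apply: smooth_vf_subset (coord_vf_smooth mfd c l).
  exact: sWc.
Qed.

Lemma gamma_coord_smooth c k a l :
  smooth_on (phi c @` dom c) (fun u => christoffel D c (psi c u) k a l : R^o).
Proof.
have oc := dom_open mfd c; have oO := range_open mfd c.
have sD := con_smooth cD oc (coord_vf_smooth mfd c a) (coord_vf_smooth mfd c l).
have := sD c; rewrite setIid => sDc.
apply: (smooth_eq oO _ (smooth_entry 0 k oO sDc)) => u _.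
by rewrite /christoffel.
Qed.

Lemma gamma_smooth c v :
  smooth_on (phi c @` dom c) (fun u => gamma c (psi c u) v).
Proof.
have oO := range_open mfd c; apply: (smooth_entries oO) => l k.
have h : smooth_on (phi c @` dom c)
    (fun u => \sum_a v 0 a * christoffel D c (psi c u) k a l : R^o).
  apply: (smooth_sum oO) => a; apply: (smoothM oO); first exact: smooth_cst.
  exact: gamma_coord_smooth.
by apply: (smooth_eq oO _ h) => u _; rewrite mxE.
Qed.

Lemma gammaN c x v : gamma c x (- v) = - gamma c x v.
Proof.
apply/matrixP => l k; rewrite !mxE -sumrN; apply: eq_bigr => a _.
by rewrite mxE mulNr.
Qed.

(** Transformation law of the connection matrix between the distinguished chart
    and a chart [c]: both sides are D_v applied to the coordinate fields of [c]. *)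
Lemma gamma_change c x v : dom c x ->
  gamma c x (v *m cjac (ch x) c x) *m cjac c (ch x) x =
  'D_v (fun u => cjac c (ch x) (psi (ch x) u)) (phi (ch x) x)
  + cjac c (ch x) x *m gamma (ch x) x v.
Proof.
set i := ch x => dc; have di : dom i x := dom_ch mfd x.
apply/row_matrixP => l.
rewrite row_mul -cov_coord_vf // -mulmxA (jacK mfd) // mulmx1.
rewrite {1}/const_vf -mulmxA (jacK mfd) // mulmx1.
rewrite (connectionE v (dom_open mfd c) (coord_vf_smooth mfd c l) dc) -/i.
rewrite [RHS]linearD /= row_mul -/i coord_vfE /const_vf -/i -rowE; congr (_ + _).
have dL : derivable (fun u => cjac c i (psi i u)) (phi i x) v.
  apply: smooth_derivable (jac_smooth_in mfd i c i) _.
  by exists x.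
have [_ E] := is_derive_mull (ebase R l) (derivableP dL); rewrite rowE -E.
apply: near_eq_derive.
apply: filterS (near_psi mfd (dom_open mfd c) dc di) => u /(img_psi mfd)[dcu diu e].
rewrite -[u in LHS]e (componentsE mfd) // -mulmxA.
by rewrite (jac_cocycle mfd) //; exact: dom_ch.
Qed.

End Connection.

End LocalFields.

(** * Local form of a Norden structure and of its canonical connection *)

Lemma scalar_sum (R : pzRingType) (V : lmodType R) (f : V -> R) (I : Type)
    (r : seq I) (a : I -> R) (v : I -> V) : scalar f ->
  f (\sum_(i <- r) a i *: v i) = \sum_(i <- r) a i * f (v i).
Proof.
move=> lf; elim: r => [|i r IH]; last by rewrite !big_cons lf IH.
rewrite !big_nil; have := lf (-1) 0 0.
by rewrite scaler0 addr0 mulN1r addNr.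
Qed.

Lemma mulmx_form (R : comPzRingType) (m p : nat) (A : 'M[R]_(m, p))
    (v : 'rV[R]_m) (w : 'rV[R]_p) :
  (v *m A *m w^T) 0 0 = \sum_a v 0 a * \sum_b w 0 b * A a b.
Proof.
rewrite -mulmxA mxE; apply: eq_bigr => a _; congr (_ * _).
by rewrite mxE; apply: eq_bigr => b _; rewrite mxE mulrC.
Qed.

Lemma eq_mulmx_form (R : pzRingType) (m p : nat) (A B : 'M[R]_(m, p)) :
  (forall (v : 'rV[R]_m) (w : 'rV[R]_p),
     (v *m A *m w^T) 0 0 = (v *m B *m w^T) 0 0) -> A = B.
Proof.
move=> AB; apply/matrixP => a b.
have := AB (delta_mx 0 a) (delta_mx 0 b).
by rewrite trmx_delta -!rowE -!colE !mxE.
Qed.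

Section NordenLocal.
Variables (R : realType) (n : nat) (M : atlas R n).
Variables (J : endo_field M) (g : bilin_field M).
Hypothesis nJg : norden J g.
Implicit Types (c : chart_index M) (x y : M) (W : set M).
Implicit Types (v w z : 'rV[R]_n) (X Y Z : vfield M).

Let mfd : smooth_manifold M := nor_manifold nJg.

(** The matrices of [J] and [g] at [x] in the distinguished chart. [Jmx] acts on
    rows on the right; [gmx] is a Gram matrix. *)
Definition Jmx x : 'M[R]_n := lin1_mx (J x).
Definition gmx x : 'M[R]_n := \matrix_(a, b) g x (ebase R a) (ebase R b).

(** The same matrices in the chart [c]. *)
Definition Jloc c x : 'M[R]_n := cjac c (ch x) x *m Jmx x *m cjac (ch x) c x.
Definition gloc c x : 'M[R]_n :=
  cjac c (ch x) x *m gmx x *m (cjac c (ch x) x)^T.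

Lemma mul_Jmx x v : v *m Jmx x = J x v.
Proof. by rewrite /Jmx mul_lin1_mx //; exact: (nor_J_linear nJg). Qed.

Lemma gmxE x v w : g x v w = (v *m gmx x *m w^T) 0 0.
Proof.
have lin2 u t : g x u t = \sum_b t 0 b * g x u (ebase R b).
  by rewrite {1}[t]row_sum_delta scalar_sum //; exact: (nor_g_linear nJg).
rewrite mulmx_form (nor_g_sym nJg) lin2; apply: eq_bigr => a _.
rewrite (nor_g_sym nJg) lin2; congr (_ * _).
by apply: eq_bigr => b _; rewrite mxE.
Qed.

Lemma gmx_sym x : (gmx x)^T = gmx x.
Proof. by apply/matrixP => a b; rewrite !mxE (nor_g_sym nJg). Qed.

Lemma gmx_unit x : gmx x \in unitmx.
Proof.
rewrite -row_free_unit; apply: inj_row_free => v vG.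
apply: (nor_g_nondeg nJg (x := x)) => w.
by rewrite gmxE vG mul0mx mxE.
Qed.

Lemma Jmx_sq x : Jmx x *m Jmx x = - 1%:M.
Proof.
apply: eq_mulmx_row => v; rewrite mulmxA !mul_Jmx (nor_J_sq nJg).
by rewrite mulmxN mulmx1.
Qed.

Lemma Jmx_gmx x : Jmx x *m gmx x = gmx x *m (Jmx x)^T.
Proof.
apply: eq_mulmx_form => v w; have := nor_compat nJg x v w.
by rewrite -!mul_Jmx !gmxE trmx_mul !mulmxA.
Qed.

Lemma Jloc_ch x : Jloc (ch x) x = Jmx x.
Proof. by rewrite /Jloc (jac_ch mfd) mul1mx mulmx1. Qed.

Lemma gloc_ch x : gloc (ch x) x = gmx x.
Proof. by rewrite /gloc (jac_ch mfd) mul1mx trmx1 mulmx1. Qed.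

Lemma gloc_unit c x : dom c x -> gloc c x \in unitmx.
Proof.
move=> dc; have dx := dom_ch mfd x.
by rewrite /gloc !unitmx_mul unitmx_tr gmx_unit (jac_unit mfd).
Qed.

Lemma components_J c X x : dom c x ->
  components c (apply_endo J X) (phi c x) =
  components c X (phi c x) *m Jloc c x.
Proof.
move=> dc; have dx := dom_ch mfd x.
rewrite !(componentsE mfd) // /apply_endo -mul_Jmx /Jloc !mulmxA.
by rewrite -(mulmxA _ (cjac (ch x) c x)) (jacK mfd) // mulmx1.
Qed.

Lemma g_const_vf c v w x :
  g x (const_vf c v x) (const_vf c w x) = (v *m gloc c x *m w^T) 0 0.
Proof. by rewrite gmxE /const_vf /gloc trmx_mul !mulmxA. Qed.

Lemma Jloc_smooth c : smooth_on (phi c @` dom c) (fun u => Jloc c (psi c u)).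
Proof.
have oO := range_open mfd c; have oc := dom_open mfd c.
apply: (smooth_entries oO) => a b.
have := nor_J_smooth nJg oc (const_vf_smooth mfd c (ebase R a)) c.
rewrite setIid => sJ; apply: (smooth_eq oO _ (smooth_entry 0 b oO sJ)) => u [x dx <-].
rewrite components_J // components_const_vf // (phiK mfd) //.
by rewrite -rowE mxE.
Qed.

Lemma gloc_smooth c : smooth_on (phi c @` dom c) (fun u => gloc c (psi c u)).
Proof.
have oO := range_open mfd c; have oc := dom_open mfd c.
apply: (smooth_entries oO) => a b.
have := nor_g_smooth nJg oc (const_vf_smooth mfd c (ebase R a))
  (const_vf_smooth mfd c (ebase R b)) c.
rewrite setIid; apply: (smooth_eq oO) => u _ /=.
by rewrite g_const_vf trmx_delta -rowE -colE !mxE.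
Qed.

Section Canonical.
Variable D : connection M.
Hypothesis natD : natural_canonical J g D.

Let cD : linear_connection D := nat_connection natD.
Let u0 x : 'rV[R]_n := phi (ch x) x.

Lemma phi_ch_range x : (phi (ch x) @` dom (ch x)) (phi (ch x) x).
Proof. by exists x => //; exact: dom_ch. Qed.

Lemma connection_const_ch x v w :
  D x v (const_vf (ch x) w) = w *m gamma D (ch x) x v.
Proof.
have dx := dom_ch mfd x.
rewrite (connectionE mfd cD v (dom_open mfd (ch x)) (const_vf_smooth mfd _ w) dx).
by rewrite (derive_components_const_vf mfd) add0r (const_vf_ch mfd).
Qed.

Lemma apply_J_smooth W Y : open W -> smooth_vf W Y -> smooth_vf W (apply_endo J Y).
Proof. exact: (nor_J_smooth nJg). Qed.

(** D J = 0. The explicit formula for D amounts to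
    D_v Y = (nabla_v Y - J nabla_v (J Y)) / 2, which commutes with J. *)
Lemma connection_J W Y x v : open W -> smooth_vf W Y -> W x ->
  D x v (apply_endo J Y) = J x (D x v Y).
Proof.
move=> oW sY Wx; have [nabla [cN _ _] formula] := nat_formula natD.
have oW' : open (W `&` dom (ch x)) := openI oW (dom_open mfd (ch x)).
have Wx' : (W `&` dom (ch x)) x by split=> //; exact: dom_ch.
(* The formula is used for the field with constant components [v] near [x]. *)
have sX : smooth_vf (W `&` dom (ch x)) (const_vf (ch x) v).
  by apply: smooth_vf_subset (const_vf_smooth mfd (ch x) v) => y [].
have sY' : smooth_vf (W `&` dom (ch x)) Y by apply: smooth_vf_subset sY => y [].
have sJY := apply_J_smooth oW' sY'.
have := formula _ _ _ oW' sX sY' x Wx'; rewrite /cov (const_vf_ch mfd) => ->.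
have := formula _ _ _ oW' sX sJY x Wx'; rewrite /cov (const_vf_ch mfd) => ->.
have -> : apply_endo J (apply_endo J Y) = fun y => (-1) *: Y y.
  by apply/funext => y; rewrite /apply_endo (nor_J_sq nJg) scaleN1r.
rewrite (connectionZ cN (-1) v oW' sY' Wx') -!mul_Jmx.
set a := nabla x v (apply_endo J Y); set b := nabla x v Y.
have JJ z : z *m Jmx x *m Jmx x = - z by rewrite -mulmxA Jmx_sq mulmxN mulmx1.
rewrite scaleN1r !mulmxBl -scalemxAl !mulmxBl !JJ mulNmx.
move: a (b *m Jmx x) => a s; apply/rowP => k; rewrite !mxE.
by lra.
Qed.

Let A x u := Jloc (ch x) (psi (ch x) u).
Let G x u := gloc (ch x) (psi (ch x) u).
Let Gam x v := gamma D (ch x) x v.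

(** Derivatives, along [v], of the matrices of [J] and [g] and of the connection
    matrix in direction [w], in the distinguished chart at [x]. *)
Definition dJ x v : 'M[R]_n := 'D_v (A x) (u0 x).
Definition dg x v : 'M[R]_n := 'D_v (G x) (u0 x).
Definition dgamma x v w : 'M[R]_n :=
  'D_v (fun u => gamma D (ch x) (psi (ch x) u) w) (u0 x).

Lemma is_derive_J x v : is_derive (u0 x) v (A x) (dJ x v).
Proof.
by apply: derivableP; apply: smooth_derivable (Jloc_smooth (ch x)) (phi_ch_range x).
Qed.

Lemma is_derive_g x v : is_derive (u0 x) v (G x) (dg x v).
Proof.
by apply: derivableP; apply: smooth_derivable (gloc_smooth (ch x)) (phi_ch_range x).
Qed.

Lemma is_derive_gamma x v w : is_derive (u0 x) v
  (fun u => gamma D (ch x) (psi (ch x) u) w) (dgamma x v w).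
Proof.
apply: derivableP.
exact: smooth_derivable (gamma_smooth mfd cD (ch x) w) (phi_ch_range x).
Qed.

Lemma near_ch x : \forall u \near u0 x, (phi (ch x) @` dom (ch x)) u.
Proof.
by apply: open_nbhs_nbhs; split; [exact: range_open|exact: phi_ch_range].
Qed.

Lemma derive_components_J_const x v w :
  'D_v (components (ch x) (apply_endo J (const_vf (ch x) w))) (u0 x) = w *m dJ x v.
Proof.
have [_ <-] := is_derive_mull w (is_derive_J x v).
apply: near_eq_derive; apply: filterS (near_ch x) => u [y dy <-].
by rewrite components_J // components_const_vf // /A (phiK mfd).
Qed.

Lemma dJE x v : dJ x v = Gam x v *m Jmx x - Jmx x *m Gam x v.
Proof.
apply: eq_mulmx_row => w; have dx := dom_ch mfd x.
have sw := const_vf_smooth mfd (ch x) w.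
have := connection_J v (dom_open mfd (ch x)) sw dx.
rewrite (connectionE mfd cD v (dom_open mfd (ch x))
  (apply_J_smooth (dom_open mfd (ch x)) sw) dx).
rewrite connection_const_ch derive_components_J_const /apply_endo.
rewrite (const_vf_ch mfd) -!mul_Jmx -/(Gam x v) mulmxBr !mulmxA => <-.
by rewrite addrK.
Qed.

(** D g = 0. *)
Lemma dgE x v : dg x v = Gam x v *m gmx x + gmx x *m (Gam x v)^T.
Proof.
apply: eq_mulmx_form => w z; have dx := dom_ch mfd x.
have sc t := const_vf_smooth mfd (ch x) t.
have := nat_metric natD (dom_open mfd (ch x)) (sc v) (sc w) (sc z) dx.
rewrite /cov !(const_vf_ch mfd) !connection_const_ch -/(Gam x v).
rewrite /dirder -addrA -opprD => /eqP; rewrite subr_eq0 => /eqP E.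
have -> : (w *m dg x v *m z^T) 0 0 = 'D_v ((fun y => g y (const_vf (ch x) w y)
    (const_vf (ch x) z y)) \o psi (ch x) : _ -> R^o) (u0 x).
  have hd := is_derive_mulr z^T (is_derive_mull w (is_derive_g x v)).
  have [_ <-] := (is_derive_entries _ _ _ _).1 hd 0 0.
  by apply: near_eq_derive; apply: filterS (near_ch x) => u _; rewrite /= g_const_vf.
by rewrite E !gmxE trmx_mul !mulmxDr !mulmxDl !mulmxA [RHS]mxE.
Qed.

Lemma torsionE W X Y x : open W -> smooth_vf W X -> smooth_vf W Y -> W x ->
  torsion D X Y x = Y x *m Gam x (X x) - X x *m Gam x (Y x).
Proof.
move=> oW sX sY Wx; rewrite /torsion /cov.
rewrite (connectionE mfd cD _ oW sY Wx) (connectionE mfd cD _ oW sX Wx) /lie.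
rewrite -/(Gam x (X x)) -/(Gam x (Y x)).
move: ('D_(X x) _ _) ('D_(Y x) _ _) (_ *m _) (_ *m _) => a b s t.
by apply/rowP => k; rewrite !mxE; lra.
Qed.

(** T(J v, w) + T(v, J w) = 0. *)
Lemma torsion_JE x v w :
  w *m Gam x (v *m Jmx x) - v *m Jmx x *m Gam x w
  + w *m Jmx x *m Gam x v - v *m Gam x (w *m Jmx x) = 0.
Proof.
have dx := dom_ch mfd x; have od := dom_open mfd (ch x).
have sc t := const_vf_smooth mfd (ch x) t.
have sJ t := apply_J_smooth od (sc t).
have := nat_torsion natD od (sc v) (sc w) dx.
rewrite (torsionE od (sJ v) (sc w) dx) (torsionE od (sc v) (sJ w) dx).
by rewrite /apply_endo !(const_vf_ch mfd) -!mul_Jmx addrA.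
Qed.

Hypothesis flatD : flat_connection D.

(** Both sides are second covariant derivatives, along [v] and [w] in either
    order, of fields with constant components. *)
Lemma flatE x v w :
  dgamma x v w + Gam x w *m Gam x v = dgamma x w v + Gam x v *m Gam x w.
Proof.
apply: eq_mulmx_row => z.
have dx := dom_ch mfd x; have od := dom_open mfd (ch x).
have sc t := const_vf_smooth mfd (ch x) t.
have sD t := con_smooth cD od (sc t) (sc z).
have second t s : D x t (cov D (const_vf (ch x) s) (const_vf (ch x) z)) =
    z *m (dgamma x t s + Gam x s *m Gam x t).
  rewrite (connectionE mfd cD t od (sD s) dx) mulmxDr mulmxA -/(Gam x t).
  congr (_ + _).
    have [_ <-] := is_derive_mull z (is_derive_gamma x t s).
    apply: near_eq_derive; apply: filterS (near_ch x) => u [y dy <-].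
    by rewrite (componentsE mfd) // (phiK mfd) // (cov_const_vf mfd cD).
  by congr (_ *m _); rewrite /cov (const_vf_ch mfd) connection_const_ch.
have := flatD od (sc v) (sc w) (sc z) dx.
rewrite /curvature /cov !(const_vf_ch mfd) (lie_const_vf mfd).
rewrite (connection_dir0 cD od (sc z) dx) subr0.
have E := second; rewrite /cov in E; rewrite !E.
by move/eqP; rewrite subr_eq0 => /eqP.
Qed.

End Canonical.
End NordenLocal.

(** * The Nijenhuis tensor in coordinates *)

Lemma addmxE (V : nmodType) p q (A B : 'M[V]_(p, q)) i j :
  (A + B) i j = A i j + B i j.
Proof. by rewrite mxE. Qed.

Lemma oppmxE (V : zmodType) p q (A : 'M[V]_(p, q)) i j : (- A) i j = - A i j.
Proof. by rewrite mxE. Qed.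

Lemma scalemxE (V : pzRingType) p q (a : V) (A : 'M[V]_(p, q)) i j :
  (a *: A) i j = a * A i j.
Proof. by rewrite mxE. Qed.

Lemma zeromxE (V : nmodType) p q i j : (0 : 'M[V]_(p, q)) i j = 0.
Proof. by rewrite mxE. Qed.

Lemma nijenhuis_bracket_algebra (R : realFieldType) (m : nat)
    (a b s t x y : 'rV[R]_m) (F d1 d2 d3 d4 : 'M[R]_m) : F *m F = - 1%:M ->
  a *m F + y *m d1 - (b *m F + x *m d2) - (a - (t *m F + x *m d3)) *m F
  - (s *m F + y *m d4 - b) *m F - (s - t)
  = y *m d1 - x *m d2 + x *m d3 *m F - y *m d4 *m F.
Proof.
move=> FF; have FFr (Z : 'rV[R]_m) : Z *m F *m F = - Z.
  by rewrite -mulmxA FF mulmxN mulmx1.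
rewrite !(mulmxDl, mulNmx) !FFr.
move: (a *m F) (b *m F) (y *m d1) (x *m d2) (x *m d3 *m F) (y *m d4 *m F).
move=> {}a {}b c1 c2 c3 c4.
by apply/rowP => k; rewrite !mxE; lra.
Qed.

(** In coordinates the derivatives of X and Y cancel from N(X, Y), which thus
    depends only on X p, Y p, and the first derivatives of the matrix [F]. *)
Lemma nijenhuis_coord (R : realType) (m : nat) (N : atlas R m) (K : endo_field N)
    (F : 'rV[R]_m -> 'M[R]_m) (X Y : vfield N) (p : N) :
  let u := phi (ch p) p in let F0 := F u in
  let dF v := 'D_v F u in
  smooth_manifold N ->
  (forall Z : vfield N, \forall w \near u,
     components (ch p) (apply_endo K Z) w = components (ch p) Z w *m F w) ->
  (forall v, derivable F u v) ->
  (forall v, derivable (components (ch p) X) u v) ->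
  (forall v, derivable (components (ch p) Y) u v) ->
  F0 *m F0 = - 1%:M -> (forall v, K p v = v *m F0) ->
  nijenhuis K X Y p =
    Y p *m dF (X p *m F0) - X p *m dF (Y p *m F0)
    + X p *m dF (Y p) *m F0 - Y p *m dF (X p) *m F0.
Proof.
move=> u F0 dF mfd nK hF hX hY FF KF.
have dK Z v : (forall v, derivable (components (ch p) Z) u v) ->
    'D_v (components (ch p) (apply_endo K Z)) u =
    'D_v (components (ch p) Z) u *m F0 + Z p *m dF v.
  move=> hZ; have [_ E] := is_derive_mulmx (derivableP (hZ v)) (derivableP (hF v)).
  rewrite (components_ch mfd) in E; rewrite -E.
  by apply: near_eq_derive; exact: nK.
rewrite /nijenhuis /lie -/u !dK // /apply_endo !KF.
set a := 'D_(X p *m F0) (components _ Y) u.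
set b := 'D_(Y p *m F0) (components _ X) u.
set s := 'D_(X p) (components _ Y) u.
set t := 'D_(Y p) (components _ X) u.
exact: nijenhuis_bracket_algebra.
Qed.

(** Pointwise data of a flat canonical connection: [A], [G] are the matrices of J
    and g, [dA], [dG] their derivatives, [Gam v] is the connection matrix in
    direction v, [S v w] stands for d_v Gamma_w + Gamma_w Gamma_v, and [y] is the
    base covector. *)
Section NijenhuisAlgebra.
Variables (R : realType) (n : nat).
Implicit Types (v w z al be y : 'rV[R]_n).
Variables (A G : 'M[R]_n) (Gam dA dG : 'rV[R]_n -> 'M[R]_n).
Variables (S : 'rV[R]_n -> 'rV[R]_n -> 'M[R]_n) (y : 'rV[R]_n).
Hypothesis AA : A *m A = - 1%:M.
Hypothesis AG : A *m G = G *m A^T.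
Hypothesis GamN : forall v, Gam (- v) = - Gam v.
Hypothesis dAE : forall v, dA v = Gam v *m A - A *m Gam v.
Hypothesis dGE : forall v, dG v = Gam v *m G + G *m (Gam v)^T.
Hypothesis SC : forall v w, S v w = S w v.
Hypothesis tor : forall v w, w *m Gam (v *m A) - v *m A *m Gam w
  + w *m A *m Gam v - v *m Gam (w *m A) = 0.

(** The Nijenhuis tensor of J on the base. With D J = 0 it equals
    J T(J v, w) + J T(v, J w) + T(v, w) - T(J v, J w), so it vanishes by the
    torsion identity at (v, w) and at (v, J w). *)
Lemma nijenhuis_algebra1 v w :
  w *m dA (v *m A) - v *m dA (w *m A) + v *m dA w *m A - w *m dA v *m A = 0.
Proof.
have AAr q (Z : 'M[R]_(q, n)) : Z *m A *m A = - Z by rewrite -mulmxA AA mulmxN mulmx1.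
have t1 := congr1 (mulmx ^~ A) (tor v w).
have t2 := tor v (w *m A).
move: t1 t2; rewrite !dAE /= !(mulmxDl, mulmxDr, mulmxBl, mulmxBr, mulNmx,
  mulmxN, mulmxA, AAr, mul0mx, GamN).
move=> /rowP t1 /rowP t2; apply/rowP => k; move: (t1 k) (t2 k).
by rewrite !(addmxE, oppmxE, zeromxE) => e1 e2; lra.
Qed.

(** Derivative of the horizontal lift of [w] along the tangent vector of the
    cotangent bundle with horizontal part [v] and vertical part [th]. *)
Let Q v th w : 'rV[R]_n := y *m (S v w)^T + th *m (Gam w)^T.

(** The vertical part of the Nijenhuis tensor on the horizontal and vertical parts
    (v, al) and (w, be): the terms in [y] cancel by symmetry of [S], those in [al]
    and [be] by D J = 0, and, since D g = 0, the rest is g applied to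
    T(J v, w) + T(v, J w). *)
Lemma nijenhuis_algebra2 v w al be :
  (w *m dG (v *m A) + Q (v *m A) (v *m G - al *m A^T) (w *m A)
   + Q (v *m A) (v *m G - al *m A^T) w *m A^T - be *m (dA (v *m A))^T)
  - (v *m dG (w *m A) + Q (w *m A) (w *m G - be *m A^T) (v *m A)
   + Q (w *m A) (w *m G - be *m A^T) v *m A^T - al *m (dA (w *m A))^T)
  + (v *m dA w *m G
     - (v *m dG w + Q w be (v *m A) + Q w be v *m A^T - al *m (dA w)^T) *m A^T)
  - (w *m dA v *m G
     - (w *m dG v + Q v al (w *m A) + Q v al w *m A^T - be *m (dA v)^T) *m A^T)
  = 0.
Proof.
have ATr q (Z : 'M[R]_(q, n)) : Z *m A^T *m A^T = - Z.
  by rewrite -mulmxA -trmx_mul AA raddfN /= trmx1 mulmxN mulmx1.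
have GAr q (Z : 'M[R]_(q, n)) : Z *m G *m A^T = Z *m A *m G.
  by rewrite -!mulmxA AG.
have t1 := congr1 (mulmx ^~ G) (tor v w); move: t1.
rewrite /Q (SC (w *m A) (v *m A)) (SC (w *m A) v) (SC w (v *m A)) (SC w v).
have trB (P1 P2 : 'M[R]_n) : (P1 - P2)^T = P1^T - P2^T by rewrite linearB.
rewrite !dAE !dGE !trB !trmx_mul.
rewrite !(mulmxDl, mulmxDr, mulmxBl, mulmxBr, mulNmx, mulmxN, mulmxA, ATr, GAr,
  mul0mx).
move=> /rowP t1; apply/rowP => k; move: (t1 k).
rewrite !(addmxE, oppmxE, zeromxE) => e1.
by lra.
Qed.
(** Here [E v th] is the tangent vector with horizontal part [v] and vertical part
    [th], and [F] is the matrix of the transported structure. *)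
Lemma nijenhuis_algebra (m : nat) (E : 'rV[R]_n -> 'rV[R]_n -> 'rV[R]_m)
    (F : 'M[R]_m) (dF : 'rV[R]_m -> 'M[R]_m) v w al be :
  (forall v th, E v th *m F = E (v *m A) (v *m G - th *m A^T)) ->
  (forall v th w be, E w be *m dF (E v th) =
     E (w *m dA v) (w *m dG v + Q v th (w *m A) + Q v th w *m A^T
                    - be *m (dA v)^T)) ->
  (forall v th w be, E v th + E w be = E (v + w) (th + be)) ->
  (forall v th, - E v th = E (- v) (- th)) -> E 0 0 = 0 ->
  E w be *m dF (E v al *m F) - E v al *m dF (E w be *m F)
  + E v al *m dF (E w be) *m F - E w be *m dF (E v al) *m F = 0.
Proof.
move=> EF EdF ED EN E00; rewrite !EF !EdF !EF !EN !ED -[RHS]E00.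
congr E; [exact: nijenhuis_algebra1|exact: nijenhuis_algebra2].
Qed.

End NijenhuisAlgebra.

(** * The transported structure on the cotangent bundle *)

Section BlockMatrices.
Variables (R : realType) (n : nat).
Implicit Types A G P K L : 'M[R]_n.

(** The isomorphism Phi^D, acting on rows [row_mx X xi]; [P] is the matrix
    y_k Gamma^k_{al}. *)
Definition lift_mx P : 'M[R]_(n + n) := block_mx 1%:M P 0 1%:M.
(** The Norden structure on T_x M (+) T_x^* M, for J and g with matrices [A] and
    [G]. *)
Definition Jhat_mx A G : 'M[R]_(n + n) := block_mx A G 0 (- A^T).
(** The Gram matrix of the metric; a covector [xi] is sent to the tangent vector
    [xi *m invmx G], whence the last block. *)
Definition ghat_mx A G : 'M[R]_(n + n) :=
  block_mx G (2^-1 *: A) (2^-1 *: A^T) (invmx G).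
(** The structure transported through Phi^D. *)
Definition Jtilde_mx A G P := invmx (lift_mx P) *m Jhat_mx A G *m lift_mx P.
Definition gtilde_mx A G P :=
  invmx (lift_mx P) *m ghat_mx A G *m (invmx (lift_mx P))^T.

Lemma lift_mxN P : lift_mx (- P) *m lift_mx P = 1%:M.
Proof.
rewrite /lift_mx mulmx_block !mul1mx !mul0mx !mulmx0 !mulmx1 !addr0 !add0r subrr.
by rewrite -scalar_mx_block.
Qed.

Lemma lift_mx_unit P : lift_mx P \in unitmx.
Proof. by case: (mulmx1_unit (lift_mxN P)). Qed.

Lemma invmx_lift P : invmx (lift_mx P) = lift_mx (- P).
Proof.
rewrite -[RHS]mulmx1 -(mulmxV (lift_mx_unit P)).
by rewrite mulmxA lift_mxN mul1mx.
Qed.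

Lemma Jtilde_mxE A G P :
  Jtilde_mx A G P = block_mx A (A *m P + G + P *m A^T) 0 (- A^T).
Proof.
rewrite /Jtilde_mx invmx_lift /lift_mx /Jhat_mx !mulmx_block.
by rewrite !(mul1mx, mul0mx, mulmx0, mulmx1, addr0, add0r) mulmxN mulNmx opprK addrA.
Qed.

Section Norden.
Variables A G : 'M[R]_n.
Hypothesis AA : A *m A = - 1%:M.
Hypothesis AG : A *m G = G *m A^T.
Hypothesis uG : G \in unitmx.
Hypothesis GT : G^T = G.

Lemma Jhat_mx_sq : Jhat_mx A G *m Jhat_mx A G = - 1%:M.
Proof.
rewrite /Jhat_mx mulmx_block !mul0mx !mulmx0 !addr0 !add0r mulmxN AG subrr.
rewrite mulNmx mulmxN opprK -trmx_mul AA raddfN /= trmx1.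
by rewrite [1%:M in RHS]scalar_mx_block opp_block_mx !oppr0.
Qed.

Lemma ghat_mx_sym : (ghat_mx A G)^T = ghat_mx A G.
Proof. by rewrite /ghat_mx tr_block_mx trmx_inv !linearZ /= trmxK GT. Qed.

Lemma Jhat_ghat_mx : Jhat_mx A G *m ghat_mx A G = ghat_mx A G *m (Jhat_mx A G)^T.
Proof.
have GA : A^T *m invmx G = invmx G *m A.
  rewrite -[LHS]mul1mx -(mulVmx uG) -(mulmxA _ G) (mulmxA G) -AG -(mulmxA A).
  by rewrite mulmxV ?mulmx1.
have ATAT : A^T *m A^T = - 1%:M by rewrite -trmx_mul AA raddfN /= trmx1.
rewrite /Jhat_mx /ghat_mx tr_block_mx !mulmx_block trmx0 !mul0mx !mulmx0 !add0r.
rewrite raddfN /= trmxK GT.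
rewrite -!scalemxAl -!scalemxAr AA ATAT (mulmxV uG) (mulVmx uG) AG !mulNmx !mulmxN.
rewrite AA ATAT -GA.
suff -> : 2^-1 *: - 1%:M + 1%:M = 2^-1 *: - - 1%:M :> 'M[R]_n by [].
by apply/matrixP => a b; rewrite !mxE; lra.
Qed.

(** Nondegeneracy: eliminating the covector part leaves (1 + 1/4) v G = 0. *)
Lemma ghat_mx_inj (w : 'rV[R]_(n + n)) : w *m ghat_mx A G = 0 -> w = 0.
Proof.
rewrite -[w]hsubmxK; set v := lsubmx w; set al := rsubmx w.
rewrite /ghat_mx mul_row_block -[RHS]row_mx0.
move=> /eq_row_mx [e1 e2].
have ea : al = - (2^-1 *: (v *m A *m G)).
  have := congr1 (mulmx ^~ G) e2.
  rewrite mulmxDl mul0mx -(mulmxA al) (mulVmx uG) mulmx1 -scalemxAr -scalemxAl.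
  by move/eqP; rewrite addrC addr_eq0 => /eqP.
have vG : v *m G = 0.
  have AGA : v *m A *m G *m A^T = - (v *m G).
    by rewrite -!mulmxA -AG (mulmxA A) AA mulNmx mul1mx mulmxN.
  move: e1; rewrite ea -scalemxAr mulNmx -scalemxAl AGA.
  move: (v *m G) => t /rowP e; apply/rowP => k; move: (e k).
  by rewrite !mxE; lra.
have v0 : v = 0 by rewrite -[v]mulmx1 -(mulmxV uG) mulmxA vG mul0mx.
by rewrite ea v0 !mul0mx scaler0 oppr0 row_mx0.
Qed.

End Norden.

(** Effect of a change of basis [K], with inverse [L], of the tangent space. *)
Lemma Jhat_mx_change A G K L : K *m L = 1%:M -> L *m K = 1%:M ->
  Jhat_mx A G *m block_mx K 0 0 L^T =
  block_mx K 0 0 L^T *m Jhat_mx (L *m A *m K) (L *m G *m L^T).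
Proof.
move=> KL LK; rewrite /Jhat_mx !mulmx_block !mul0mx !mulmx0 !addr0 !add0r.
have LTKT : L^T *m K^T = 1%:M by rewrite -trmx_mul KL trmx1.
by rewrite !mulmxA !KL !mul1mx mulNmx mulmxN !trmx_mul !mulmxA LTKT mul1mx.
Qed.

Lemma ghat_mx_change A G K L : K *m L = 1%:M -> L *m K = 1%:M ->
  G \in unitmx ->
  ghat_mx A G = block_mx K 0 0 L^T *m ghat_mx (L *m A *m K) (L *m G *m L^T)
                *m (block_mx K 0 0 L^T)^T.
Proof.
move=> KL LK uG; have LTKT : L^T *m K^T = 1%:M by rewrite -trmx_mul KL trmx1.
have uL : L \in unitmx by case: (mulmx1_unit LK).
set Gc := L *m G *m L^T.
have uGc : Gc \in unitmx by rewrite !unitmx_mul unitmx_tr uL uG.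
have iG : invmx G = L^T *m invmx Gc *m L.
  rewrite -[RHS]mulmx1 -(mulmxV uG) mulmxA -(mulmxA _ L G).
  have -> : L *m G = Gc *m K^T by rewrite /Gc -!mulmxA LTKT mulmx1.
  by rewrite mulmxA -(mulmxA _ _ Gc) (mulVmx uGc) mulmx1 LTKT mul1mx.
rewrite /ghat_mx tr_block_mx !mulmx_block !trmx0 trmxK.
rewrite !mul0mx !mulmx0 !addr0 !add0r -iG; congr block_mx.
- by rewrite /Gc !mulmxA KL mul1mx -mulmxA LTKT mulmx1.
- by rewrite -scalemxAr -scalemxAl !mulmxA KL mul1mx -mulmxA KL mulmx1.
- rewrite -scalemxAr -scalemxAl !trmx_mul !mulmxA LTKT mul1mx.
  by rewrite -mulmxA LTKT mulmx1.
Qed.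

End BlockMatrices.

Lemma is_derive_lsubmx (R : realType) (p q : nat) (u V : 'rV[R]_(p + q)) :
  is_derive u V (lsubmx : 'rV[R]_(p + q) -> 'rV[R]_p) (lsubmx V).
Proof.
have df := differentiable_lsubmx u.
split; first exact: diff_derivable.
rewrite deriveE //.
rewrite (@diff_lin _ _ _ (lsubmx : {linear 'rV[R]_(p + q) -> 'rV[R]_p})) //.
exact: continuous_lsubmx.
Qed.

Lemma is_derive_rsubmx (R : realType) (p q : nat) (u V : 'rV[R]_(p + q)) :
  is_derive u V (rsubmx : 'rV[R]_(p + q) -> 'rV[R]_q) (rsubmx V).
Proof.
have df := differentiable_rsubmx u.
split; first exact: diff_derivable.
rewrite deriveE //.
rewrite (@diff_lin _ _ _ (rsubmx : {linear 'rV[R]_(p + q) -> 'rV[R]_q})) //.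
exact: continuous_rsubmx.
Qed.

Lemma is_derive_comp_lsubmx (R : realType) (p q : nat) (W : normedModType R)
    (F : 'rV[R]_p -> W) (u V : 'rV[R]_(p + q)) :
  differentiable F (lsubmx u) ->
  is_derive u V (fun w => F (lsubmx w)) ('D_(lsubmx V) F (lsubmx u)).
Proof.
move=> dF; have dl := differentiable_lsubmx u; split.
  by apply: diff_derivable; exact: (differentiable_comp dl dF).
have [_ <-] := is_derive_lsubmx u V.
exact: (derive_comp V dl dF).
Qed.

Lemma form_change (R : comPzRingType) (m : nat) (X Y : 'rV[R]_m)
    (P E F T Q : 'M[R]_m) : P *m E = T *m Q ->
  X *m (P *m (E *m F *m E^T) *m P^T) *m Y^T =
  X *m T *m (Q *m F *m Q^T) *m (Y *m T)^T.
Proof.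
move=> PE; have -> : P *m (E *m F *m E^T) *m P^T = (P *m E) *m F *m (P *m E)^T.
  by rewrite trmx_mul !mulmxA.
by rewrite PE !trmx_mul !mulmxA.
Qed.

Section CotangentStructure.
Variables (R : realType) (n : nat) (M : atlas R n).
Variables (J : endo_field M) (g : bilin_field M) (D : connection M).
Hypothesis nJg : norden J g.
Hypothesis natD : natural_canonical J g D.
Implicit Types (c : chart_index M) (x : M).
Implicit Types (v th al be y : 'rV[R]_n) (u V w : 'rV[R]_(n + n)).
Implicit Types (p : cotangent M).

Let mfd : smooth_manifold M := nor_manifold nJg.
Let cmfd : smooth_manifold (cotangent M) := cotangent_manifold mfd.
Let cD : linear_connection D := nat_connection natD.

(** The matrix y_k Gamma^k_{al} of the horizontal lift. *)
Definition lift_coeff c x y : 'M[R]_n :=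
  \matrix_(a, l) \sum_k y 0 k * christoffel D c x k a l.

Lemma mul_lift_coeff c x y v : v *m lift_coeff c x y = y *m (gamma D c x v)^T.
Proof.
apply/rowP => l; rewrite !mxE.
under eq_bigr do rewrite mxE mulr_sumr.
rewrite exchange_big /=; apply: eq_bigr => k _.
rewrite !mxE mulr_sumr; apply: eq_bigr => a _.
by rewrite mulrCA.
Qed.

Lemma PhiD_mxE p :
  PhiD_mx D p = lift_mx (lift_coeff (ch (base p)) (base p) (fiber p)).
Proof. by []. Qed.

Lemma JhatE x w : Jhat J g x w = w *m Jhat_mx (Jmx J x) (gmx g x).
Proof.
have flatE v : musical_flat g x v = v *m gmx g x.
  by apply/rowP => a; rewrite mxE (gmxE nJg) trmx_delta -colE mxE.
have JsE y : Jstar J x y = y *m (Jmx J x)^T.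
  apply/rowP => a; rewrite mxE /pairing mxE; apply: eq_bigr => b _.
  by rewrite -(mul_Jmx nJg) -rowE !mxE.
rewrite /Jhat -[w in RHS]hsubmxK /Jhat_mx mul_row_block mulmx0 addr0 mulmxN.
by rewrite (mul_Jmx nJg) flatE JsE.
Qed.

Lemma musical_sharpE x y : musical_sharp g x y = y *m invmx (gmx g x).
Proof.
rewrite /musical_sharp; congr (_ *m invmx _).
by apply/matrixP => a b; rewrite /lin1_mx !mxE.
Qed.

Lemma ghatE x w w' :
  ghat J g x w w' = (w *m ghat_mx (Jmx J x) (gmx g x) *m w'^T) 0 0.
Proof.
have uG := gmx_unit nJg x; have GT := gmx_sym nJg x.
rewrite /ghat -[w in RHS]hsubmxK -[w' in RHS]hsubmxK /ghat_mx mul_row_block.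
rewrite tr_row_mx mul_row_col !musical_sharpE !(gmxE nJg) -!(mul_Jmx nJg).
set v := lsubmx w; set al := rsubmx w; set v' := lsubmx w'; set al' := rsubmx w'.
rewrite !trmx_mul trmx_inv GT !mulmxA.
rewrite -(mulmxA _ (invmx _) (gmx g x)) (mulVmx uG) mulmx1.
rewrite -(mulmxA _ (gmx g x) (invmx _)) (mulmxV uG) mulmx1.
rewrite !mulmxDl -!scalemxAr -!scalemxAl !addmxE !scalemxE.
by rewrite !addrA; congr (_ + _); rewrite -!addrA; congr (_ + _); rewrite addrC.
Qed.

Lemma JtildeE p w : Jtilde J g D p w =
  w *m Jtilde_mx (Jmx J (base p)) (gmx g (base p))
         (lift_coeff (ch (base p)) (base p) (fiber p)).
Proof. by rewrite /Jtilde /PhiD /PhiD_inv JhatE PhiD_mxE /Jtilde_mx !mulmxA. Qed.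

Lemma gtildeE p w w' : gtilde J g D p w w' =
  (w *m gtilde_mx (Jmx J (base p)) (gmx g (base p))
         (lift_coeff (ch (base p)) (base p) (fiber p)) *m w'^T) 0 0.
Proof.
by rewrite /gtilde /PhiD_inv ghatE PhiD_mxE /gtilde_mx trmx_mul !mulmxA.
Qed.

(** ** Change of chart on the cotangent bundle *)

Section ChartChange.
Variables (c : chart_index M) (p : cotangent M).
Let x := base p.
Let i := ch x.
Hypothesis dc : dom c x.
Let di : dom i x := dom_ch mfd x.
Let K := cjac i c x.
Let L := cjac c i x.

Let KL : K *m L = 1%:M. Proof. exact: (jacK mfd). Qed.
Let LK : L *m K = 1%:M. Proof. exact: (jacK mfd). Qed.

Lemma cot_phi_ch : cot_phi i p = row_mx (phi i x) (fiber p).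
Proof. by rewrite cot_phiE (jac_ch mfd) trmx1 mulmx1. Qed.

(** The differential of the change of charts of the cotangent bundle,
    (x, y) |-> (tau x, y (L x)^T). *)
Lemma mul_cot_cjac v th :
  row_mx v th *m cjac (i : chart_index (cotangent M)) c p =
  row_mx (v *m K) (th *m L^T + fiber p *m
    ('D_v (fun t => cjac c i (psi i t)) (phi i x))^T).
Proof.
rewrite (mul_jac cmfd) //=.
have dtau := transition_differentiable mfd di dc.
have dL : differentiable (fun t => cjac c i (psi i t)) (phi i x).
  apply: smooth_differentiable (jac_smooth_in mfd i c i) _.
  by exists x.
have el : lsubmx (cot_phi i p) = phi i x by rewrite cot_phi_ch row_mxKl.
have er : rsubmx (cot_phi i p) = fiber p by rewrite cot_phi_ch row_mxKr.
rewrite -el in dtau dL.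
have h1 := is_derive_comp_lsubmx (row_mx v th) dtau.
have h2 := is_derive_mulmx (is_derive_rsubmx (cot_phi i p) (row_mx v th))
  (is_derive_trmx (is_derive_comp_lsubmx (row_mx v th) dL)).
have [_ E] := is_derive_row_mx h1 h2.
move: E; rewrite row_mxKl row_mxKr er el (phiK mfd di).
rewrite -(mul_jac mfd v di dc) => <-.
apply: near_eq_derive.
have iu : (phi i @` (dom i `&` dom c)) (lsubmx (cot_phi i p)).
  by rewrite el; exists x.
have oO : open
    [set u : 'rV[R]_(n + n) | (phi i @` (dom i `&` dom c)) (lsubmx u)].
  apply: lsubmx_preimage_open; rewrite setIC.
  exact: (img_open mfd i (dom_open mfd c)).
by apply: (near_open oO iu) => u uO; rewrite (cot_transitionE mfd).
Qed.

(** Phi^D does not depend on the chart: this is the transformation law of the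
    connection matrix. *)
Lemma lift_change :
  lift_mx (lift_coeff i x (fiber p)) *m cjac (i : chart_index (cotangent M)) c p =
  block_mx K 0 0 L^T *m lift_mx (lift_coeff c x (fiber p *m L^T)).
Proof.
apply: eq_mulmx_row => w; rewrite -[w]hsubmxK.
set v := lsubmx w; set th := rsubmx w.
rewrite !mulmxA /lift_mx !mul_row_block !mulmx1 !mulmx0 !addr0 !add0r.
rewrite mul_cot_cjac; congr row_mx.
rewrite !mul_lift_coeff -[fiber p *m L^T *m _]mulmxA -trmx_mul.
rewrite (gamma_change mfd cD v dc) linearD /= trmx_mul mulmxDr mulmxDl !mulmxA.
by apply/rowP => k; rewrite !addmxE; lra.
Qed.

(** The transported structure has the same expression in every chart. *)
Lemma Jtilde_change X :
  components (c : chart_index (cotangent M)) (apply_endo (Jtilde J g D) X)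
    (cot_phi c p) =
  components (c : chart_index (cotangent M)) X (cot_phi c p) *m
    Jtilde_mx (Jloc J c x) (gloc g c x)
      (lift_coeff c x (rsubmx (cot_phi c p))).
Proof.
rewrite !(componentsE cmfd (c := c)) //= /apply_endo JtildeE.
have -> : rsubmx (cot_phi c p) = fiber p *m L^T by rewrite cot_phiE row_mxKr.
have E := lift_change.
rewrite /Jtilde_mx -/x -/i -!mulmxA E.
rewrite (mulmxA (Jhat_mx _ _)) (Jhat_mx_change _ _ KL LK) !mulmxA.
congr (_ *m _ *m _).
rewrite -!mulmxA; congr (_ *m _).
have uc := lift_mx_unit (lift_coeff c x (fiber p *m L^T)).
have ui := lift_mx_unit (lift_coeff i x (fiber p)).
rewrite -[LHS]mulmx1 -(mulmxV uc) mulmxA -(mulmxA (invmx _) _ (lift_mx _)) -E.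
by rewrite mulmxA (mulVmx ui) mul1mx.
Qed.

Lemma gtilde_change (X Y : vfield (cotangent M)) :
  gtilde J g D p (X p) (Y p) =
  (components (c : chart_index (cotangent M)) X (cot_phi c p) *m
    gtilde_mx (Jloc J c x) (gloc g c x)
      (lift_coeff c x (rsubmx (cot_phi c p))) *m
   (components (c : chart_index (cotangent M)) Y (cot_phi c p))^T) 0 0.
Proof.
rewrite !(componentsE cmfd (c := c)) //= gtildeE.
have -> : rsubmx (cot_phi c p) = fiber p *m L^T by rewrite cot_phiE row_mxKr.
have E := lift_change.
set Pc := lift_coeff c x _ in E *; set Pi := lift_coeff i x _ in E.
have uc := lift_mx_unit Pc; have ui := lift_mx_unit Pi.
have E' : invmx (lift_mx Pi) *m block_mx K 0 0 L^T =
    cjac (i : chart_index (cotangent M)) c p *m invmx (lift_mx Pc).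
  rewrite -[LHS]mulmx1 -(mulmxV uc) mulmxA -(mulmxA (invmx _) _ (lift_mx _)) -E.
  by rewrite mulmxA (mulVmx ui) mul1mx.
rewrite /gtilde_mx -/x -/i -/Pi (ghat_mx_change _ KL LK (gmx_unit nJg x)).
rewrite -[L *m Jmx J x *m K]/(Jloc J c x) -[L *m gmx g x *m L^T]/(gloc g c x).
exact: (congr1 (fun B : 'M[R]_1 => B 0 0) (form_change (X p) (Y p) _ E')).
Qed.

End ChartChange.

(** ** Smoothness *)

(** The matrices of J, of g and of the horizontal lift in the chart [c], as
    functions of the coordinates [u] = (x, y) of the cotangent bundle. *)
Let Aof c u := Jloc J c (psi c (lsubmx u)).
Let Gof c u := gloc g c (psi c (lsubmx u)).
Let Pof c u := lift_coeff c (psi c (lsubmx u)) (rsubmx u).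

Lemma comp_lsubmx_smooth q r c (F : 'rV[R]_n -> 'M[R]_(q, r)) :
  smooth_on (phi c @` dom c) F ->
  smooth_on (cot_phi c @` cot_dom c) (fun u => F (lsubmx u)).
Proof.
have oU : open (cot_phi c @` cot_dom c) := cot_range_open mfd (i := c).
apply: (smooth_comp oU (range_open mfd c)).
  by move=> u; rewrite (cot_rangeE mfd).
exact: smooth_lsubmx (smooth_id oU).
Qed.

Lemma lift_coeff_smooth c : smooth_on (cot_phi c @` cot_dom c) (Pof c).
Proof.
have oU : open (cot_phi c @` cot_dom c) := cot_range_open mfd (i := c).
have oO := range_open mfd c.
apply: (smooth_entries oU) => a l.
have sk : smooth_on (cot_phi c @` cot_dom c) (fun u =>
    \sum_k (rsubmx u) 0 k * christoffel D c (psi c (lsubmx u)) k a l : R^o).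
  apply: (smooth_sum oU) => k; apply: (smoothM oU).
    exact: (smooth_entry 0 k oU (smooth_rsubmx oU (smooth_id oU))).
  apply: (smooth_comp_scalar oU _ _ (gamma_coord_smooth mfd cD c k a l)).
    by move=> u; rewrite (cot_rangeE mfd).
  exact: smooth_lsubmx (smooth_id oU).
by apply: (smooth_eq oU _ sk) => u _; rewrite mxE.
Qed.

Lemma Jtilde_mx_smooth c : smooth_on (cot_phi c @` cot_dom c)
  (fun u => Jtilde_mx (Aof c u) (Gof c u) (Pof c u)).
Proof.
have oU : open (cot_phi c @` cot_dom c) := cot_range_open mfd (i := c).
have sA := comp_lsubmx_smooth (Jloc_smooth nJg c).
have sG := comp_lsubmx_smooth (gloc_smooth nJg c).
have sP := lift_coeff_smooth c.
have sN : smooth_on (cot_phi c @` cot_dom c) (fun u => block_mx (Aof c u)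
    (Aof c u *m Pof c u + Gof c u + Pof c u *m (Aof c u)^T) 0 (- (Aof c u)^T)).
  apply: (smooth_block_mx oU) => //.
  - apply: (smoothD oU).
      by apply: (smoothD oU) => //; exact: (smooth_mulmx oU sA sP).
    exact: (smooth_mulmx oU sP (smooth_trmx oU sA)).
  - exact: smooth_cst.
  - exact: (smooth_oppmx oU (smooth_trmx oU sA)).
by apply: (smooth_eq oU _ sN) => u _; rewrite Jtilde_mxE.
Qed.

Lemma gtilde_mx_smooth c : smooth_on (cot_phi c @` cot_dom c)
  (fun u => gtilde_mx (Aof c u) (Gof c u) (Pof c u)).
Proof.
have oU : open (cot_phi c @` cot_dom c) := cot_range_open mfd (i := c).
have sA := comp_lsubmx_smooth (Jloc_smooth nJg c).
have sG := comp_lsubmx_smooth (gloc_smooth nJg c).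
have sP := lift_coeff_smooth c.
have sPhi : smooth_on (cot_phi c @` cot_dom c) (fun u => invmx (lift_mx (Pof c u))).
  apply: (smooth_invmx oU) => [u _|]; first exact: lift_mx_unit.
  by apply: (smooth_block_mx oU) => //; exact: smooth_cst.
apply: (smooth_mulmx oU); last exact: (smooth_trmx oU).
apply: (smooth_mulmx oU) => //; apply: (smooth_block_mx oU) => //.
- by apply: (smooth_scalemx oU) => //; exact: smooth_cst.
- by apply: (smooth_scalemx oU); [exact: smooth_cst|exact: (smooth_trmx oU)].
- apply: (smooth_invmx oU) => // u; rewrite (cot_rangeE mfd) => -[x dx e].
  by rewrite /Gof -e (phiK mfd dx); exact: (gloc_unit nJg).
Qed.

Lemma components_Jtilde c (X : vfield (cotangent M)) u :
  (cot_phi c @` cot_dom c) u ->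
  components (c : chart_index (cotangent M)) (apply_endo (Jtilde J g D) X) u =
  components (c : chart_index (cotangent M)) X u *m
    Jtilde_mx (Aof c u) (Gof c u) (Pof c u).
Proof.
move=> [p dp <-]; rewrite (Jtilde_change dp) /Aof /Gof /Pof.
by rewrite cot_phiE row_mxKl (phiK mfd).
Qed.

Lemma Jtilde_smooth (W : set (cotangent M)) X : open W -> smooth_vf W X ->
  smooth_vf W (apply_endo (Jtilde J g D) X).
Proof.
move=> oW sX c; have oO := img_open cmfd c oW.
have sJ : smooth_on (phi c @` (W `&` dom c))
    (fun u => Jtilde_mx (Aof c u) (Gof c u) (Pof c u)).
  apply: smooth_subset (Jtilde_mx_smooth c) => u [p [_ dp] <-].
  by exists p.
apply: (smooth_eq oO _ (smooth_mulmx oO (sX c) sJ)) => u [p [_ dp] <-].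
by rewrite components_Jtilde //; exists p.
Qed.

Lemma gtilde_smooth (W : set (cotangent M)) X Y : open W ->
  smooth_vf W X -> smooth_vf W Y ->
  smooth_fun W (fun p => gtilde J g D p (X p) (Y p)).
Proof.
move=> oW sX sY c; have oO := img_open cmfd c oW.
have sG : smooth_on (phi c @` (W `&` dom c))
    (fun u => gtilde_mx (Aof c u) (Gof c u) (Pof c u)).
  apply: smooth_subset (gtilde_mx_smooth c) => u [p [_ dp] <-].
  by exists p.
have h := smooth_mulmx oO (smooth_mulmx oO (sX c) sG) (smooth_trmx oO (sY c)).
apply: (smooth_eq oO _ (smooth_entry 0 0 oO h)) => u [p [_ dp] <-].
rewrite /= (cot_phiK mfd dp) (gtilde_change dp) /Aof /Gof /Pof.
by rewrite cot_phiE row_mxKl (phiK mfd).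
Qed.

(** ** Integrability *)

Hypothesis flatD : flat_connection D.

Section Integrability.
Variable p : cotangent M.
Let x := base p.
Let c := ch x.
Let u0 : 'rV[R]_(n + n) := cot_phi c p.
Let y := rsubmx u0.
(** [A], [G], [P], [Gam], [S] and [Q] are the data of the algebraic computation
    above, at the point [p]. *)
Let A := Jmx J x.
Let G := gmx g x.
Let P := lift_coeff c x y.
Let Gam v := gamma D c x v.
Let S v (w : 'rV[R]_n) := dgamma D x v w + Gam w *m Gam v.
Let Q v th (w : 'rV[R]_n) : 'rV[R]_n := y *m (S v w)^T + th *m (Gam w)^T.
Let F u := Jtilde_mx (Aof c u) (Gof c u) (Pof c u).
(** The tangent vector at [p] with horizontal part [v] and vertical part [th]. *)
Let E v th : 'rV[R]_(n + n) := row_mx v (th + v *m P).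

Let dx : dom c x := dom_ch mfd x.

Let u0_range : (cot_phi c @` cot_dom c) u0. Proof. by exists p. Qed.

Let lu0 : lsubmx u0 = phi c x. Proof. by rewrite /u0 cot_phiE row_mxKl. Qed.

Let F0 : F u0 = block_mx A (A *m P + G + P *m A^T) 0 (- A^T).
Proof.
rewrite /F Jtilde_mxE /Aof /Gof /Pof lu0 (phiK mfd) //.
by rewrite (Jloc_ch nJg) (gloc_ch nJg).
Qed.

Let EF v th : E v th *m F u0 = E (v *m A) (v *m G - th *m A^T).
Proof.
rewrite F0 /E mul_row_block mulmx0 addr0; congr row_mx.
rewrite !mulmxDr mulmxN mulmxDl !mulmxA.
by apply/rowP => k; rewrite !(addmxE, oppmxE); lra.
Qed.

Let dP V := 'D_V (Pof c) u0.

Let mul_dP v th (w : 'rV[R]_n) : w *m dP (E v th) = Q v th w.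
Proof.
have hP : is_derive u0 (E v th) (Pof c) (dP (E v th)).
  by apply: derivableP; exact: smooth_derivable (lift_coeff_smooth c) u0_range.
have [_ <-] := is_derive_mull w hP.
have -> : (fun u => w *m Pof c u) =
    (fun u => rsubmx u *m (gamma D c (psi c (lsubmx u)) w)^T).
  by apply/funext => u; rewrite mul_lift_coeff.
have dg : differentiable (fun t => gamma D c (psi c t) w) (lsubmx u0).
  apply: smooth_differentiable (gamma_smooth mfd cD c w) _.
  by rewrite lu0; exists x.
have [_ ->] := is_derive_mulmx (is_derive_rsubmx u0 (E v th))
  (is_derive_trmx (is_derive_comp_lsubmx (E v th) dg)).
rewrite /E row_mxKl row_mxKr lu0 (phiK mfd dx) mul_lift_coeff -/y.
rewrite /Q /S /dgamma -/c linearD /= trmx_mul mulmxDr mulmxDl !mulmxA.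
rewrite -/(Gam w) -/(Gam v).
by rewrite addrC addrA addrAC.
Qed.

Let dF v th : 'D_(E v th) F u0 =
  block_mx (dJ J x v)
    (dJ J x v *m P + A *m dP (E v th) + dg g x v
     + (dP (E v th) *m A^T + P *m (dJ J x v)^T)) 0 (- (dJ J x v)^T).
Proof.
have hP : is_derive u0 (E v th) (Pof c) (dP (E v th)).
  by apply: derivableP; exact: smooth_derivable (lift_coeff_smooth c) u0_range.
have hA : is_derive u0 (E v th) (Aof c) (dJ J x v).
  have dA : differentiable (fun t => Jloc J c (psi c t)) (lsubmx u0).
    apply: smooth_differentiable (Jloc_smooth nJg c) _.
    by rewrite lu0; exists x.
  by have := is_derive_comp_lsubmx (E v th) dA; rewrite /E row_mxKl lu0.
have hG : is_derive u0 (E v th) (Gof c) (dg g x v).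
  have dG : differentiable (fun t => gloc g c (psi c t)) (lsubmx u0).
    apply: smooth_differentiable (gloc_smooth nJg c) _.
    by rewrite lu0; exists x.
  by have := is_derive_comp_lsubmx (E v th) dG; rewrite /E row_mxKl lu0.
have -> : F = fun u => block_mx (Aof c u)
    (Aof c u *m Pof c u + Gof c u + Pof c u *m (Aof c u)^T) 0 (- (Aof c u)^T).
  by apply/funext => u; rewrite /F Jtilde_mxE.
have hAT := is_derive_trmx hA.
have hB := is_deriveD (is_deriveD (is_derive_mulmx hA hP) hG)
  (is_derive_mulmx hP hAT).
have [_ ->] := is_derive_block_mx hA hB (is_derive_cst 0 u0 (E v th))
  (is_deriveN hAT).
by rewrite /Aof /Gof /Pof lu0 (phiK mfd dx) (Jloc_ch nJg).
Qed.

Let EdF v th (w : 'rV[R]_n) be : E w be *m 'D_(E v th) F u0 =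
  E (w *m dJ J x v) (w *m dg g x v + Q v th (w *m A) + Q v th w *m A^T
                     - be *m (dJ J x v)^T).
Proof.
have rearrange (a b d e f h : 'rV[R]_n) :
    a + b + d + (e + f) + - (h + f) = d + b + e - h + a.
  by apply/rowP => k; rewrite !mxE; lra.
rewrite dF {1}/E mul_row_block mulmx0 addr0 /E.
by rewrite -!mul_dP !mulmxDr mulmxN mulmxDl !mulmxA rearrange.
Qed.

Lemma nijenhuis_Jtilde (W : set (cotangent M)) (X Y : vfield (cotangent M)) :
  open W -> smooth_vf W X -> smooth_vf W Y -> W p ->
  nijenhuis (Jtilde J g D) X Y p = 0.
Proof.
move=> oW sX sY Wp.
have FF : F u0 *m F u0 = - 1%:M.
  apply: eq_mulmx_row => t.
  have -> : t = E (lsubmx t) (rsubmx t - lsubmx t *m P).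
    by rewrite /E subrK hsubmxK.
  rewrite mulmxA !EF mulmxN mulmx1 /E opp_row_mx.
  have AA := Jmx_sq nJg x; have AG := Jmx_gmx nJg x.
  rewrite -/A -/G in AA AG *.
  have AAr q (Z : 'M[R]_(q, n)) : Z *m A *m A = - Z by rewrite -mulmxA AA mulmxN mulmx1.
  have ATr q (Z : 'M[R]_(q, n)) : Z *m A^T *m A^T = - Z.
    by rewrite -mulmxA -trmx_mul AA raddfN /= trmx1 mulmxN mulmx1.
  have GAr q (Z : 'M[R]_(q, n)) : Z *m G *m A^T = Z *m A *m G.
    by rewrite -!mulmxA AG.
  rewrite AAr; congr row_mx.
  rewrite mulmxBl GAr ATr mulNmx.
  by apply/rowP => k; rewrite !(addmxE, oppmxE); lra.
have KF V : Jtilde J g D p V = V *m F u0.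
  rewrite JtildeE /F /Aof /Gof /Pof lu0 (phiK mfd dx) (Jloc_ch nJg) (gloc_ch nJg).
  by rewrite /u0 cot_phi_ch row_mxKr.
have nK (Z : vfield (cotangent M)) : \forall w \near phi (ch p) p,
    components (ch p) (apply_endo (Jtilde J g D) Z) w = components (ch p) Z w *m F w.
  have nr : nbhs u0 (cot_phi c @` cot_dom c).
    apply: open_nbhs_nbhs; split; [exact: (cot_range_open mfd)|exact: u0_range].
  by apply: filterS nr => w rw; exact: components_Jtilde.
have hF V : derivable F (phi (ch p) p) V.
  exact: smooth_derivable (Jtilde_mx_smooth c) u0_range.
have hd (Z : vfield (cotangent M)) V : smooth_vf W Z ->
    derivable (components (ch p) Z) (phi (ch p) p) V.
  by move=> sZ; apply: smooth_derivable (sZ (ch p)) _; exists p.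
rewrite (nijenhuis_coord cmfd nK hF (fun V => hd X V sX) (fun V => hd Y V sY) FF KF).
rewrite -[phi (ch p) p]/u0.
(* Split X p and Y p into horizontal and vertical parts. *)
have EE t : t = E (lsubmx t) (rsubmx t - lsubmx t *m P).
  by rewrite /E subrK hsubmxK.
rewrite (EE (X p)) (EE (Y p)).
move: (lsubmx (X p)) (rsubmx (X p) - _) => v al.
move: (lsubmx (Y p)) (rsubmx (Y p) - _) => w be.
have ED a1 b1 a2 b2 : E a1 b1 + E a2 b2 = E (a1 + a2) (b1 + b2).
  rewrite /E add_row_mx mulmxDl; congr row_mx.
  by apply/rowP => k; rewrite !addmxE; lra.
have EN a1 b1 : - E a1 b1 = E (- a1) (- b1).
  by rewrite /E opp_row_mx opprD mulNmx.
have GamN t : Gam (- t) = - Gam t by exact: gammaN.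
have SC s t : S s t = S t s by exact: (flatE nJg natD flatD).
have AA := Jmx_sq nJg x; have AG := Jmx_gmx nJg x.
have dAE s : dJ J x s = Gam s *m A - A *m Gam s := dJE nJg natD x s.
have dGE s : dg g x s = Gam s *m G + G *m (Gam s)^T := dgE nJg natD x s.
have tor := torsion_JE nJg natD x.
have E00 : E 0 0 = 0 by rewrite /E mul0mx addr0 row_mx0.
exact: (nijenhuis_algebra (dF := fun V => 'D_V F u0) AA AG GamN dAE dGE SC tor
  v w al be EF EdF ED EN E00).
Qed.

End Integrability.

Lemma cotangent_norden : norden (Jtilde J g D) (gtilde J g D).
Proof.
split.
- exact: cmfd.
- by move=> p a v w; rewrite !JtildeE mulmxDl -scalemxAl.
- exact: Jtilde_smooth.
- move=> p v; rewrite !JtildeE -mulmxA.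
  set P := lift_coeff _ _ _; have uP := lift_mx_unit P.
  rewrite /Jtilde_mx !mulmxA -(mulmxA _ (lift_mx P) (invmx _)) (mulmxV uP) mulmx1.
  rewrite -(mulmxA _ (Jhat_mx _ _) (Jhat_mx _ _)).
  rewrite (Jhat_mx_sq (Jmx_sq nJg _) (Jmx_gmx nJg _)).
  by rewrite mulmxN mulmx1 mulNmx -mulmxA (mulVmx uP) mulmx1.
- move=> p v a s t; rewrite !gtildeE linearD linearZ /= mulmxDr -scalemxAr.
  by rewrite addmxE scalemxE.
- move=> p v w; rewrite !gtildeE.
  set B := gtilde_mx _ _ _; have BT : B^T = B.
    by rewrite /B /gtilde_mx !trmx_mul trmxK (ghat_mx_sym _ (gmx_sym nJg _)) !mulmxA.
  move: B BT => B BT.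
  have trE (Z : 'M[R]_1) : Z 0 0 = Z^T 0 0 by rewrite mxE.
  by rewrite trE !trmx_mul trmxK BT mulmxA.
- move=> p v; set x := base p => h.
  have vB : v *m gtilde_mx (Jmx J x) (gmx g x) (lift_coeff (ch x) x (fiber p)) = 0.
    apply: (can_inj trmxK); apply/matrixP => a b.
    have := h (delta_mx 0 a); rewrite gtildeE trmx_delta -colE !mxE.
    by rewrite ord1.
  set P := lift_coeff _ _ _ in vB; have uP := lift_mx_unit P.
  have uPi : (invmx (lift_mx P))^T \in unitmx by rewrite unitmx_tr unitmx_inv.
  have : v *m invmx (lift_mx P) = 0.
    apply: (ghat_mx_inj (Jmx_sq nJg x) (Jmx_gmx nJg x) (gmx_unit nJg x)).
    rewrite -[LHS]mulmx1 -(mulmxV uPi) !mulmxA.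
    by move: vB; rewrite /gtilde_mx !mulmxA => ->; rewrite mul0mx.
  move=> /(congr1 (mulmx ^~ (lift_mx P))).
  by rewrite mul0mx -mulmxA (mulVmx uP) mulmx1.
- exact: gtilde_smooth.
- move=> p v w; rewrite !gtildeE !JtildeE.
  set P := lift_coeff _ _ _; have uP := lift_mx_unit P.
  rewrite trmx_mul !mulmxA; congr ((_ *m _) 0 0).
  rewrite -!mulmxA; congr (_ *m _).
  rewrite /Jtilde_mx /gtilde_mx !trmx_mul !mulmxA.
  rewrite -(mulmxA _ (lift_mx P) (invmx _)) (mulmxV uP) mulmx1.
  have VT : (invmx (lift_mx P))^T *m (lift_mx P)^T = 1%:M.
    by rewrite -trmx_mul (mulmxV uP) trmx1.
  rewrite -(mulmxA _ (invmx _)^T (lift_mx P)^T) VT mulmx1.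
  rewrite -(mulmxA _ (Jhat_mx _ _) (ghat_mx _ _)).
  rewrite (Jhat_ghat_mx (Jmx_sq nJg _) (Jmx_gmx nJg _) (gmx_unit nJg _)
    (gmx_sym nJg _)).
  by rewrite !mulmxA.
Qed.

End CotangentStructure.

Theorem proposition4p3 (R : realType) (n : nat) (M : atlas R n)
    (J : endo_field M) (g : bilin_field M) (D : connection M) :
  complex_norden J g ->
  natural_canonical J g D ->
  flat_connection D ->
  complex_norden (Jtilde J g D) (gtilde J g D).
Proof.
move=> [nJg _] natD flatD; split; first exact: cotangent_norden.
by move=> W X Y oW sX sY p Wp; exact: (nijenhuis_Jtilde nJg natD flatD oW sX sY Wp).
Qed.
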